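(* On cyclic $\mathbb Q$-modules, the (non-normalized) shuffle map $sh$ admits a natural coextension of length $2$. That is, there exist maps $sh'_n:(P_*\otimes Q_* )_n\to(P\times Q)_{n+2}$ ($n\ge0$), natural in the cyclic $\mathbb Q$-modules $P,Q$, such that, on the non-normalized complexes, $$[b,sh']+[B,sh]=0\qquad\text{and}\qquad[B,sh']=0,$$ where $[b,f]=bf-fb$ and $[B,f]=Bf-fB$.
   Context: Cyclic $\mathbb Q$-modules: simplicial $\mathbb Q$-vector spaces $P$ with operators $t_n:P_n\to P_n$ such that $t_n^{n+1}=1$, $d_it_n=t_{n-1}d_{i-1}$ and $s_it_n=t_{n+1}s_{i-1}$ for $1\le i\le n$, $d_0t_n=d_n$, $s_0t_n=t_{n+1}^2s_n$. $P_*$ denotes the non-normalized complex with $b=\sum_{i=0}^n(-1)^id_i:P_n\to P_{n-1}$ and Connes' operator $B:P_n\to P_{n+1}$, $B=TrN$ with $T_m=1-(-1)^mt_m$, $r_n=t_{n+1}s_n$, $N_n=\sum_{i=0}^n(-1)^{ni}t_n^i$. $P\times Q$ is the cyclic module $(P\times Q)_n=P_n\otimes Q_n$ with diagonal structure. On $P_*\otimes Q_*$ (total degree), $b(x\otimes y)=bx\otimes y+(-1)^px\otimes by$ and $B(x\otimes y)=Bx\otimes y+(-1)^px\otimes By$ for $x\in P_p$. The shuffle $sh:P_*\otimes Q_*\to(P\times Q)_*$ is $sh(x\otimes y)=\sum\varepsilon(\mu,\nu)(s_{\nu_q}\cdots s_{\nu_1}x)\otimes(s_{\mu_p}\cdots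 s_{\mu_1}y)$ for $x\in P_p,y\in Q_q$, summed over partitions $\{\mu_1<\dots<\mu_p\}\sqcup\{\nu_1<\dots<\nu_q\}=\{0,\dots,p+q-1\}$, with $\varepsilon(\mu,\nu)$ the signature of $(\mu_1,\dots,\mu_p,\nu_1,\dots,\nu_q)$. A coextension of a morphism of $b$-complexes $f$ is a sequence $(f_m)_{m\ge0}$ with $f_0=f$, $f_m$ of degree $2m$, and $[b,f_m]+[B,f_{m-1}]=0$ for all $m$ ($f_{-1}=0$); it is of length $2$ if $f_m=0$ for $m\ge2$. *)

(* Defs.v *)
From HB Require Import structures.
From mathcomp Require Import all_boot perm all_algebra.
From mathcomp Require Import boolp freeg.

Set Implicit Arguments.
Unset Strict Implicit.
Unset Printing Implicit Defensive.

Import GRing.Theory.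
Local Open Scope ring_scope.
Local Open Scope quotient_scope.

(* The tensor product of modules over a commutative ring: the free module on  *)
(* U * V modulo the submodule generated by the bilinearity relations.         *)

Section Tensor.
Variables (R : comNzRingType) (U V : lmodType R).

Notation F := {freeg (U * V)%type / R}.

Definition pair_gen (u : U) (v : V) : F := << 1 *g (u, v) >>.

Inductive tensor_rel : F -> Prop :=
| Tensor_rel0 : tensor_rel 0
| Tensor_relD a x y : tensor_rel x -> tensor_rel y -> tensor_rel (a *: x + y)
| Tensor_rell a u u' v :
    tensor_rel (pair_gen (a *: u + u') v - (a *: pair_gen u v + pair_gen u' v))
| Tensor_relr a u v v' :
    tensor_rel (pair_gen u (a *: v + v') - (a *: pair_gen u v + pair_gen u v')).

Definition tensor_ker : {pred F} := fun x => `[< tensor_rel x >].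

Lemma tensor_kerP x : reflect (tensor_rel x) (x \in tensor_ker).
Proof. exact: asboolP. Qed.

Fact tensor_ker_submod : submod_closed tensor_ker.
Proof.
split=> [|a x y /tensor_kerP rx /tensor_kerP ry]; apply/tensor_kerP.
  exact: Tensor_rel0.
exact: Tensor_relD.
Qed.
HB.instance Definition _ := GRing.isSubmodClosed.Build R F tensor_ker
  tensor_ker_submod.

Definition tensor := Quotient.quot tensor_ker.

HB.instance Definition _ := GRing.Zmodule.on tensor.
HB.instance Definition _ := EqQuotient.on tensor.
HB.instance Definition _ := ZmodQuotient.on tensor.

Definition tpi (x : F) : tensor := \pi_tensor x.

Lemma tpi_eq x y : (tpi x = tpi y) <-> tensor_rel (x - y).
Proof.
split=> [/eqP|]; rewrite /tpi.
  by rewrite -Quotient.idealrBE => /tensor_kerP.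
by move/tensor_kerP; rewrite Quotient.idealrBE => /eqP.
Qed.

Lemma tpiD : {morph tpi : x y / x + y}.
Proof. by move=> x y; rewrite /tpi !piE. Qed.

Definition tensor_scale (a : R) (x : tensor) : tensor := tpi (a *: repr x).

Lemma tpiZ a x : tensor_scale a (tpi x) = tpi (a *: x).
Proof.
apply/tpi_eq; rewrite -scalerBr.
apply/tensor_kerP/rpredZ/tensor_kerP/tpi_eq.
by rewrite /tpi reprK.
Qed.

Lemma tpiW (P : tensor -> Prop) : (forall x, P (tpi x)) -> forall x, P x.
Proof. by move=> Pq x; rewrite -[x]reprK; apply: Pq. Qed.

Fact tensor_scaleA a b x :
  tensor_scale a (tensor_scale b x) = tensor_scale (a * b) x.
Proof. by elim/tpiW: x => x; rewrite !tpiZ scalerA. Qed.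
Fact tensor_scale1 : left_id 1 tensor_scale.
Proof. by elim/tpiW => x; rewrite tpiZ scale1r. Qed.
Fact tensor_scaleDr : right_distributive tensor_scale +%R.
Proof.
move=> a; elim/tpiW=> x; elim/tpiW=> y.
by rewrite -tpiD !tpiZ scalerDr tpiD.
Qed.
Fact tensor_scaleDl x : {morph tensor_scale^~ x : a b / a + b}.
Proof. by move=> a b; elim/tpiW: x => x; rewrite !tpiZ scalerDl tpiD. Qed.

HB.instance Definition _ := GRing.Zmodule_isLmodule.Build R tensor
  tensor_scaleA tensor_scale1 tensor_scaleDr tensor_scaleDl.

Definition pure (u : U) (v : V) : tensor := tpi (pair_gen u v).

Lemma pure_bilinear : bilinear_for *:%R *:%R pure.
Proof.
split=> [v a u u'|u a v v'] /=; rewrite /pure.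
  have -> : a *: tpi (pair_gen u v) = tpi (a *: pair_gen u v) by exact: tpiZ.
  by rewrite -tpiD; apply/tpi_eq/Tensor_rell.
have -> : a *: tpi (pair_gen u v) = tpi (a *: pair_gen u v) by exact: tpiZ.
by rewrite -tpiD; apply/tpi_eq/Tensor_relr.
Qed.
HB.instance Definition _ := bilinear_isBilinear.Build R U V tensor *:%R *:%R
  pure pure_bilinear.

Section Lift.
Variables (W : lmodType R) (f : {bilinear U -> V -> W}).

Definition tensor_lift (x : tensor) : W :=
  fglift (fun uv => f uv.1 uv.2) (repr x).

Let g := fglift (R := R) (fun uv => f uv.1 uv.2).

Let gD x y : g (x + y) = g x + g y.
Proof.
have gB a b : g (a - b) = g a - g b.
  exact: (lift_is_additive (fun uv : U * V => f uv.1 uv.2)).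
by rewrite -[y in LHS]opprK gB -[- y]sub0r gB -(subrr 0) gB subrr sub0r opprK.
Qed.

Let gsum I (r : seq I) (h : I -> F) :
  g (\sum_(i <- r) h i) = \sum_(i <- r) g (h i).
Proof.
apply: (big_morph g gD).
by apply: (addrI (g 0)); rewrite -gD !addr0.
Qed.

Let gU a uv : g << a *g uv >> = a *: f uv.1 uv.2. Proof. exact: liftU. Qed.

Let gZ a x : g (a *: x) = a *: g x.
Proof.
have -> : a *: x = \sum_(k <- dom x) << a * coeff k x *g k >> by [].
rewrite gsum -[in RHS](freeg_sumE x) [in RHS]gsum scaler_sumr.
by apply: eq_bigr => i _; rewrite !gU scalerA.
Qed.

Let gker x : tensor_rel x -> g x = 0.
Proof.
have gN z : g (- z) = - g z by rewrite -[- z]scaleN1r gZ scaleN1r.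
elim=> {x} [|a x y _ gx _ gy|a u u' v|a u v v'].
- by rewrite -(scale0r 0) gZ scale0r.
- by rewrite gD gZ gx gy scaler0 addr0.
- by rewrite gD gN gD gZ !gU /= !scale1r linearPl subrr.
- by rewrite gD gN gD gZ !gU /= !scale1r linearPr subrr.
Qed.

Let lift_qpi x : tensor_lift (tpi x) = g x.
Proof.
have /tpi_eq/gker : tpi (repr (tpi x)) = tpi x by rewrite /tpi reprK.
rewrite gD -scaleN1r gZ scaleN1r => /eqP.
by rewrite subr_eq0 => /eqP.
Qed.

Fact tensor_lift_linear : linear tensor_lift.
Proof.
move=> a; elim/tpiW=> x; elim/tpiW=> y.
have -> : a *: tpi x = tpi (a *: x) by exact: tpiZ.
by rewrite -tpiD !lift_qpi gD gZ.
Qed.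
HB.instance Definition _ := GRing.isLinear.Build R tensor W _ tensor_lift
  tensor_lift_linear.

Lemma tensor_lift_pure u v : tensor_lift (pure u v) = f u v.
Proof. by rewrite lift_qpi gU scale1r. Qed.
End Lift.

Lemma tensor_ext (W : lmodType R) (f g : {linear tensor -> W}) :
  (forall u v, f (pure u v) = g (pure u v)) -> f =1 g.
Proof.
move=> fg; elim/tpiW=> x; rewrite -(freeg_sumE x).
have tpi0 : tpi 0 = 0 by apply: (addrI (tpi 0)); rewrite -tpiD !addr0.
have qsum : tpi (\sum_(z <- dom x) << coeff z x *g z >>) =
    \sum_(z <- dom x) coeff z x *: pure z.1 z.2.
  rewrite (big_morph tpi tpiD tpi0).
  apply: eq_bigr => -[u v] _ /=; rewrite /pure.
  have -> : coeff (u, v) x *: tpi (pair_gen u v) =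
    tpi (coeff (u, v) x *: pair_gen u v) by exact: tpiZ.
  congr tpi; apply/eqP/freeg_eqP => k.
  by rewrite coeffZ !coeffU mul1r.
by rewrite qsum !linear_sum; apply: eq_bigr => z _; rewrite !linearZ /= fg.
Qed.

End Tensor.

Section TensorMap.
Variables (R : comNzRingType) (U V U' V' : lmodType R).

Definition tensor_fun (f : U -> U') (g : V -> V') u v : tensor U' V' :=
  pure (f u) (g v).

Variables (f : {linear U -> U'}) (g : {linear V -> V'}).

Fact tensor_fun_bilinear : bilinear_for *:%R *:%R (tensor_fun f g).
Proof.
by split=> [v a u u'|u a v v'] /=;
  rewrite /tensor_fun linearP ?linearPl ?linearPr.
Qed.
HB.instance Definition _ := bilinear_isBilinear.Build R U V (tensor U' V')
  *:%R *:%R (tensor_fun f g) tensor_fun_bilinear.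

Definition tensor_map : {linear tensor U V -> tensor U' V'} :=
  tensor_lift (tensor_fun f g).

Lemma tensor_map_pure u v : tensor_map (pure u v) = pure (f u) (g v).
Proof. exact: tensor_lift_pure. Qed.
End TensorMap.

Section TensorMapTheory.
Variables (R : comNzRingType).

Lemma eq_tensor_map (U V U' V' : lmodType R) (f f' : {linear U -> U'})
    (g g' : {linear V -> V'}) :
  f =1 f' -> g =1 g' -> tensor_map f g =1 tensor_map f' g'.
Proof.
by move=> ff gg; apply: tensor_ext => u v; rewrite !tensor_map_pure ff gg.
Qed.

Lemma tensor_map_id (U V : lmodType R) (f : {linear U -> U})
    (g : {linear V -> V}) :
  f =1 id -> g =1 id -> tensor_map f g =1 id.
Proof.
move=> ff gg; apply: (tensor_ext (g := idfun)) => u v.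
by rewrite tensor_map_pure ff gg.
Qed.

Lemma tensor_map_comp (U V U' V' U'' V'' : lmodType R)
    (f : {linear U -> U'}) (g : {linear V -> V'})
    (f' : {linear U' -> U''}) (g' : {linear V' -> V''}) x :
  tensor_map f' g' (tensor_map f g x) = tensor_map (f' \o f) (g' \o g) x.
Proof.
apply: (tensor_ext (f := tensor_map f' g' \o tensor_map f g)) => u v.
by rewrite /= !tensor_map_pure.
Qed.
End TensorMapTheory.

(* Faces, degeneracies and relations are indexed by natural numbers; only     *)
(* d_i with i <= n on P_n and s_i with i <= n on P_n are meaningful, and the  *)
(* values outside of this range are never used.                               *)

Record cyclicModule := CyclicModule {
  cmod :> nat -> lmodType rat;
  face : forall n, nat -> {linear cmod n.+1 -> cmod n};
  degen : forall n, nat -> {linear cmod n -> cmod n.+1};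
  cyc : forall n, {linear cmod n -> cmod n};
  face_face : forall n i j, (i < j <= n.+2)%N -> forall x,
    face n i (face n.+1 j x) = face n j.-1 (face n.+1 i x);
  degen_degen : forall n i j, (i <= j <= n)%N -> forall x,
    degen n.+1 i (degen n j x) = degen n.+1 j.+1 (degen n i x);
  face_degen_lt : forall n i j, (i < j <= n.+1)%N -> forall x,
    face n.+1 i (degen n.+1 j x) = degen n j.-1 (face n i x);
  face_degen_eq : forall n j, (j <= n)%N -> forall x,
    face n j (degen n j x) = x;
  face_degen_succ : forall n j, (j <= n)%N -> forall x,
    face n j.+1 (degen n j x) = x;
  face_degen_gt : forall n i j, (j.+1 < i <= n.+2)%N -> forall x,
    face n.+1 i (degen n.+1 j x) = degen n j (face n i.-1 x);
  cyc_order : forall n x, iter n.+1 (cyc n) x = x;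
  face_cyc : forall n i, (0 < i <= n.+1)%N -> forall x,
    face n i (cyc n.+1 x) = cyc n (face n i.-1 x);
  face0_cyc : forall n x, face n 0 (cyc n.+1 x) = face n n.+1 x;
  degen_cyc : forall n i, (0 < i <= n)%N -> forall x,
    degen n i (cyc n x) = cyc n.+1 (degen n i.-1 x);
  degen0_cyc : forall n x,
    degen n 0 (cyc n x) = cyc n.+1 (cyc n.+1 (degen n n x))
}.

Record cyclicHom (P Q : cyclicModule) := CyclicHom {
  chom :> forall n, {linear P n -> Q n};
  chom_face : forall n i, (i <= n.+1)%N -> forall x,
    chom n (face P n i x) = face Q n i (chom n.+1 x);
  chom_degen : forall n i, (i <= n)%N -> forall x,
    chom n.+1 (degen P n i x) = degen Q n i (chom n x);
  chom_cyc : forall n x, chom n (cyc P n x) = cyc Q n (chom n x)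
}.

Section Product.
Variables P Q : cyclicModule.

Definition prod_mod n : lmodType rat := tensor (P n) (Q n).
Definition prod_face n i : {linear prod_mod n.+1 -> prod_mod n} :=
  tensor_map (face P n i) (face Q n i).
Definition prod_degen n i : {linear prod_mod n -> prod_mod n.+1} :=
  tensor_map (degen P n i) (degen Q n i).
Definition prod_cyc n : {linear prod_mod n -> prod_mod n} :=
  tensor_map (cyc P n) (cyc Q n).

Lemma iter_prod_cyc n m x :
  exists (f : {linear P n -> P n}) (g : {linear Q n -> Q n}),
    [/\ f =1 iter m (cyc P n), g =1 iter m (cyc Q n) &
        iter m (prod_cyc n) x = tensor_map f g x].
Proof.
elim: m => [|m [f [g [ef eg e]]]].
  by exists idfun, idfun; split=> //; rewrite tensor_map_id.
exists (cyc P n \o f), (cyc Q n \o g).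
by split=> [y|y|]; rewrite iterS ?e ?tensor_map_comp //= ?ef ?eg.
Qed.

Definition cyc_prod : cyclicModule.
Proof.
apply: (@CyclicModule prod_mod prod_face prod_degen prod_cyc).
- move=> n i j ij x; rewrite !tensor_map_comp.
  by apply: eq_tensor_map => u /=; rewrite face_face.
- move=> n i j ij x; rewrite !tensor_map_comp.
  by apply: eq_tensor_map => u /=; rewrite (degen_degen ij).
- move=> n i j ij x; rewrite !tensor_map_comp.
  by apply: eq_tensor_map => u /=; rewrite face_degen_lt.
- move=> n j ij x; rewrite !tensor_map_comp.
  by apply: tensor_map_id => u /=; rewrite face_degen_eq.
- move=> n j ij x; rewrite !tensor_map_comp.
  by apply: tensor_map_id => u /=; rewrite face_degen_succ.
- move=> n i j ij x; rewrite !tensor_map_comp.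
  by apply: eq_tensor_map => u /=; rewrite face_degen_gt.
- move=> n x; have [f [g [ef eg ->]]] := iter_prod_cyc n.+1 x.
  by apply: tensor_map_id => u; [rewrite ef|rewrite eg]; rewrite cyc_order.
- move=> n i ij x; rewrite !tensor_map_comp.
  by apply: eq_tensor_map => u /=; rewrite face_cyc.
- move=> n x; rewrite !tensor_map_comp.
  by apply: eq_tensor_map => u /=; rewrite face0_cyc.
- move=> n i ij x; rewrite !tensor_map_comp.
  by apply: eq_tensor_map => u /=; rewrite degen_cyc.
- move=> n x; rewrite !tensor_map_comp.
  by apply: eq_tensor_map => u /=; rewrite degen0_cyc.
Defined.
End Product.

(* Graded rational vector spaces with a degree -1 operator b and a degree +1  *)
(* operator B; b vanishes on degree 0.                                        *)

Record bBmodule := BBModule {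
  bBmod :> nat -> lmodType rat;
  opb : forall n, {linear bBmod n.+1 -> bBmod n};
  opB : forall n, {linear bBmod n -> bBmod n.+1}
}.

Section CyclicComplex.
Variable P : cyclicModule.

Definition cyc_b n (x : P n.+1) : P n :=
  \sum_(i < n.+2) (-1) ^+ i *: face P n i x.

Definition cyc_T n (x : P n) : P n := x - (-1) ^+ n *: cyc P n x.
Definition cyc_r n (x : P n) : P n.+1 := cyc P n.+1 (degen P n n x).
Definition cyc_N n (x : P n) : P n :=
  \sum_(i < n.+1) (-1) ^+ (n * i)%N *: iter i (cyc P n) x.
Definition cyc_B n (x : P n) : P n.+1 := cyc_T (cyc_r (cyc_N x)).

Fact cyc_b_linear n : linear (@cyc_b n).
Proof.
move=> a x y; rewrite scaler_sumr -big_split; apply: eq_bigr => i _ /=.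
by rewrite linearP scalerDr !scalerA mulrC.
Qed.
HB.instance Definition _ n :=
  GRing.isLinear.Build rat (P n.+1) (P n) _ (@cyc_b n) (@cyc_b_linear n).

Fact cyc_B_linear n : linear (@cyc_B n).
Proof.
have Nlin : linear (@cyc_N n).
  move=> a x y; rewrite scaler_sumr -big_split; apply: eq_bigr => i _ /=.
  have -> : iter i (cyc P n) (a *: x + y) =
      a *: iter i (cyc P n) x + iter i (cyc P n) y.
    by elim: (i : nat) => // m IH; rewrite !iterS IH linearP.
  by rewrite scalerDr !scalerA mulrC.
move=> a x y; rewrite /cyc_B Nlin /cyc_r !linearP /cyc_T linearP.
by rewrite !scalerDr scalerN !scalerA mulrC opprD addrACA.
Qed.
HB.instance Definition _ n :=
  GRing.isLinear.Build rat (P n) (P n.+1) _ (@cyc_B n) (@cyc_B_linear n).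

Definition cyc_complex : bBmodule :=
  {| bBmod := P; opb := fun n => @cyc_b n; opB := fun n => @cyc_B n |}.
End CyclicComplex.

(* The direct sum of the X_p (x) Y_q over the finitely many p, q with         *)
(* p + q = n, as a module of families.                                        *)

Section Total.
Variables X Y : nat -> lmodType rat.

Definition tensor_total (n : nat) : Type :=
  forall p q : nat, (p + q)%N = n -> tensor (X p) (Y q).

Variable n : nat.
Implicit Types z : tensor_total n.

HB.instance Definition _ := gen_eqMixin (tensor_total n).
HB.instance Definition _ := gen_choiceMixin (tensor_total n).

Let tadd z1 z2 : tensor_total n := fun p q e => z1 p q e + z2 p q e.
Let topp z : tensor_total n := fun p q e => - z p q e.
Let tscale (a : rat) z : tensor_total n := fun p q e => a *: z p q e.

Lemma total_ext z1 z2 : (forall p q e, z1 p q e = z2 p q e) -> z1 = z2.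
Proof.
move=> e; apply: functional_extensionality_dep => p.
apply: functional_extensionality_dep => q.
by apply: functional_extensionality_dep => ?.
Qed.

Fact total_addA : associative tadd.
Proof. by move=> *; apply: total_ext => *; apply: addrA. Qed.
Fact total_addC : commutative tadd.
Proof. by move=> *; apply: total_ext => *; apply: addrC. Qed.
Fact total_add0 : left_id ((fun _ _ _ => 0) : tensor_total n) tadd.
Proof. by move=> *; apply: total_ext => *; apply: add0r. Qed.
Fact total_addN : left_inverse ((fun _ _ _ => 0) : tensor_total n) topp tadd.
Proof. by move=> *; apply: total_ext => *; apply: addNr. Qed.
HB.instance Definition _ := GRing.isZmodule.Build (tensor_total n)
  total_addA total_addC total_add0 total_addN.

Fact total_scaleA a b z : tscale a (tscale b z) = tscale (a * b) z.
Proof. by apply: total_ext => *; apply: scalerA. Qed.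
Fact total_scale1 : left_id 1 tscale.
Proof. by move=> *; apply: total_ext => *; apply: scale1r. Qed.
Fact total_scaleDr : right_distributive tscale +%R.
Proof. by move=> *; apply: total_ext => *; apply: scalerDr. Qed.
Fact total_scaleDl z : {morph tscale^~ z : a b / a + b}.
Proof. by move=> *; apply: total_ext => *; apply: scalerDl. Qed.
HB.instance Definition _ := GRing.Zmodule_isLmodule.Build rat (tensor_total n)
  total_scaleA total_scale1 total_scaleDr total_scaleDl.

Lemma totalDE z1 z2 p q e : (z1 + z2) p q e = z1 p q e + z2 p q e.
Proof. by []. Qed.
Lemma totalZE a z p q e : (a *: z) p q e = a *: z p q e.
Proof. by []. Qed.
End Total.

Section TotalComplex.
Variables X Y : bBmodule.

Definition left_succ p q n (e : (p + q)%N = n) : (p.+1 + q)%N = n.+1 :=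
  congr1 S e.
Definition right_succ p q n (e : (p + q)%N = n) : (p + q.+1)%N = n.+1 :=
  etrans (addnS p q) (congr1 S e).
Definition left_pred p q n (e : (p.+1 + q)%N = n.+1) : (p + q)%N = n :=
  succn_inj e.
Definition right_pred p q n (e : (p + q.+1)%N = n.+1) : (p + q)%N = n :=
  succn_inj (etrans (esym (addnS p q)) e).

(* The component of b z in X_p (x) Y_q comes from the components of z in      *)
(* X_(p+1) (x) Y_q and X_p (x) Y_(q+1), and that of B z from the components   *)
(* of z in X_(p-1) (x) Y_q and X_p (x) Y_(q-1), when these exist.             *)

Definition total_b n (z : tensor_total X Y n.+1) : tensor_total X Y n :=
  fun p q e =>
  tensor_map (opb X p) idfun (z p.+1 q (left_succ e)) +
  (-1) ^+ p *: tensor_map idfun (opb Y q) (z p q.+1 (right_succ e)).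

Definition total_Bl n (z : tensor_total X Y n) : tensor_total X Y n.+1 :=
  fun p q =>
  match p return (p + q)%N = n.+1 -> tensor (X p) (Y q) with
  | 0 => fun _ => 0
  | p'.+1 => fun e => tensor_map (opB X p') idfun (z p' q (left_pred e))
  end.

Definition total_Br n (z : tensor_total X Y n) : tensor_total X Y n.+1 :=
  fun p q =>
  match q return (p + q)%N = n.+1 -> tensor (X p) (Y q) with
  | 0 => fun _ => 0
  | q'.+1 => fun e =>
      (-1) ^+ p *: tensor_map idfun (opB Y q') (z p q' (right_pred e))
  end.

Definition total_B n (z : tensor_total X Y n) : tensor_total X Y n.+1 :=
  total_Bl z + total_Br z.

Fact total_b_linear n : linear (@total_b n).
Proof.
move=> a z1 z2; apply: total_ext => p q e.
rewrite totalDE totalZE /total_b !totalDE !totalZE !linearP !scalerDr !scalerA.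
by rewrite mulrC addrACA.
Qed.
HB.instance Definition _ n := GRing.isLinear.Build rat (tensor_total X Y n.+1)
  (tensor_total X Y n) _ (@total_b n) (@total_b_linear n).

Fact total_B_linear n : linear (@total_B n).
Proof.
move=> a z1 z2; rewrite /total_B scalerDr addrACA.
congr (_ + _); apply: total_ext => -[|p] [|q] e //;
  rewrite totalDE totalZE /= ?totalDE ?totalZE ?scaler0 ?addr0 //;
  by rewrite linearP ?scalerDr ?scalerA 1?mulrC.
Qed.
HB.instance Definition _ n := GRing.isLinear.Build rat (tensor_total X Y n)
  (tensor_total X Y n.+1) _ (@total_B n) (@total_B_linear n).

Definition tensor_complex : bBmodule :=
  {| bBmod := tensor_total X Y;
     opb := fun n => @total_b n; opB := fun n => @total_B n |}.
End TotalComplex.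

Definition total_map (X X' Y Y' : nat -> lmodType rat)
    (f : forall n, {linear X n -> X' n}) (g : forall n, {linear Y n -> Y' n})
    n (z : tensor_total X Y n) : tensor_total X' Y' n :=
  fun p q e => tensor_map (f p) (g q) (z p q e).

(* degens P w p q is s_(w (q - 1)) ... s_(w 0) on P_p. *)
Fixpoint degens (P : cyclicModule) (w : nat -> nat) p q :
    {linear P p -> P (q + p)%N} :=
  match q with
  | 0 => idfun
  | q'.+1 => degen P (q' + p)%N (w q') \o degens P w p q'
  end.

Definition cmod_cast (P : cyclicModule) m n (e : m = n) : {linear P m -> P n} :=
  match e with erefl => idfun end.

Definition perm_word n (s : 'S_n) : seq nat := [seq val (s i) | i <- enum 'I_n].

(* A partition {mu_1 < ... < mu_p} U {nu_1 < ... < nu_q} of {0, ..., n - 1}   *)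
(* is encoded by the permutation with word (mu_1, ..., mu_p, nu_1, ..., nu_q).*)
Definition is_shuffle p n (s : 'S_n) : bool :=
  sorted ltn (take p (perm_word s)) && sorted ltn (drop p (perm_word s)).

Section Shuffle.
Variables P Q : cyclicModule.

Definition shuffle_pq (p q n : nat) (e : (p + q)%N = n)
    (z : tensor (P p) (Q q)) : cyc_prod P Q n :=
  \sum_(s : 'S_n | is_shuffle p s)
    (-1) ^+ s *: tensor_map
      (cmod_cast P (etrans (addnC q p) e)
         \o degens P (nth 0 (drop p (perm_word s))) p q)
      (cmod_cast Q e \o degens Q (nth 0 (take p (perm_word s))) q p) z.

Definition sh n (z : tensor_complex (cyc_complex P) (cyc_complex Q) n) :
    cyc_complex (cyc_prod P Q) n :=
  \sum_(p < n.+1)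
    shuffle_pq (subnKC (leq_ord p)) (z p (n - p)%N (subnKC (leq_ord p))).

End Shuffle.

(* The relations [b, f_m] + [B, f_(m-1)] = 0 for f_0 = f, f_1 = f' and f_m =  *)
(* 0 for m > 1, with f and f' of degrees 0 and 2; they are void for m > 2.    *)

Section Coextension.
Variables X Y : bBmodule.
Variable f : forall n, X n -> Y n.
Variable f' : forall n, X n -> Y n.+2.

Definition commb0 n (z : X n.+1) : Y n :=
  opb Y n (f z) - f (opb X n z).

Definition commB0 n (z : X n) : Y n.+1 :=
  opB Y n (f z) - f (opB X n z).

Definition commb2 n : X n -> Y n.+1 :=
  match n with
  | 0 => fun z => opb Y 1 (f' z)
  | m.+1 => fun z => opb Y m.+2 (f' z) - f' (opb X m z)
  end.

Definition commB2 n (z : X n) : Y n.+3 :=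
  opB Y n.+2 (f' z) - f' (opB X n z).

Definition coextension2 : Prop :=
  [/\ forall n (z : X n.+1), commb0 z = 0,
      forall n (z : X n), commb2 z + commB0 z = 0 &
      forall n (z : X n), commB2 z = 0].
End Coextension.

(* Main.v *)
From HB Require Import structures.
Require Import Defs.
From mathcomp Require Import all_boot perm all_algebra boolp zify.

Set Implicit Arguments.
Unset Strict Implicit.
Unset Printing Implicit Defensive.

Import GRing.Theory.
Local Open Scope ring_scope.

(** An element of degree n of a cyclic module behaves like a word of n + 1
    letters a_0, ..., a_n, as in the cyclic module of an algebra: t rotates the
    word, faces multiply neighbouring letters and degeneracies insert units.
    Put tau = (-1)^n t, T = 1 - tau and N = 1 + tau + ... + tau^n; let R insert
    a unit in front of a word, let b' be b without its last face, and let s be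
    the sign (-1)^n.  Then B = T R N, and b T = T b', b' N = N b,
    b' R = 1 - R b', T N = N T = 0.

    Three bilinear operations are used.  SH is the shuffle: the letters a_0 and
    b_0 share the first slot and the other letters are shuffled.  SH2 shuffles
    all letters, a_0 and b_0 included.  C is the cyclic shuffle, the sum of the
    shuffles of all rotations of the two words in which a_0 precedes b_0.
    Looking at slots of words one finds

      b SH = SH(b,1) + SH(s,b),           b' SH2 = SH2(b',1) - SH2(s,b'),
      T C = SH(RN,1) + SH(s,RN),          b' C = N SH - C(b,1) - C(s,b),
      C(T,1) = N SH(R,1) + SH2(s,N),      C(1,T) = N SH(s,R) - SH2(Ns,1).

    Hence [b, T R C] is T C - T R N SH = SH(RN,1) + SH(s,RN) - B SH.  On
    normalized complexes RN and B = T R N have the same effect inside SH, so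
    that T R C would be the desired map there; without normalization it is
    neither a solution of [b,sh'] + [B,sh] = 0 nor strictly compatible with B.

    Both defects can be repaired.  The arguments x are replaced by pi x, where
    pi = 1 - T R kappa and kappa is a natural operator with kappa b = - b' kappa
    and kappa B = N.  Such a kappa exists over the rationals since
    d_0 B = 2 N: it is the commutator of (1/2) R d_0 with the differentials.
    Now pi B = 0 and N pi = N, and M = T R C(pi,pi) satisfies [B,M] = 0.  The
    operator pi does not commute with b, but b pi = pi b - T kappa, and the
    error terms are given by C(T,1) and C(1,T).  The outcome is
    [b,M] = - [B,G] with G = SH(rho,rho) + (T - 1) R SH2(kappa,kappa) and
    rho = pi + R kappa.  Finally 1 - rho = b lambda + lambda b for
    lambda = R R kappa, which gives an explicit homotopy K with [b,K] = SH - G.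
    Therefore sh' = M + [B,K] has [b,sh'] = - [B,G] - [B,SH - G] = - [B,SH]
    and [B,sh'] = 0 ([comm_even_b_SHc] and [comm_even_B_SHc]).

    Shuffles are coded by masks, the sequences of booleans that tell which
    slots receive letters of x; [sum_shuffles] identifies the masks with the
    shuffle permutations.  All operations are defined on the families indexed
    by degree, and are restricted to the total complex at the end. *)

(** * Families indexed by degree and the operators of a cyclic module *)

(** No finiteness condition is put on families: an operator of any degree acts
    as an endomorphism of this one module, so that identities between operators
    can be written without transport along equalities of degrees. *)
Definition gr (M : nat -> lmodType rat) : Type := forall n, M n.

Section Graded.
Variable M : nat -> lmodType rat.
Implicit Types x y : gr M.

HB.instance Definition _ := gen_eqMixin (gr M).
HB.instance Definition _ := gen_choiceMixin (gr M).

Lemma gr_ext x y : (forall n, x n = y n) -> x = y.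
Proof. exact: functional_extensionality_dep. Qed.

Let gadd x y : gr M := fun n => x n + y n.
Let gopp x : gr M := fun n => - x n.
Let gscale (a : rat) x : gr M := fun n => a *: x n.

Fact gr_addA : associative gadd.
Proof. by move=> *; apply: gr_ext => n; apply: addrA. Qed.
Fact gr_addC : commutative gadd.
Proof. by move=> *; apply: gr_ext => n; apply: addrC. Qed.
Fact gr_add0 : left_id ((fun=> 0) : gr M) gadd.
Proof. by move=> *; apply: gr_ext => n; apply: add0r. Qed.
Fact gr_addN : left_inverse ((fun=> 0) : gr M) gopp gadd.
Proof. by move=> *; apply: gr_ext => n; apply: addNr. Qed.
HB.instance Definition _ := GRing.isZmodule.Build (gr M)
  gr_addA gr_addC gr_add0 gr_addN.

Fact gr_scaleA a b x : gscale a (gscale b x) = gscale (a * b) x.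
Proof. by apply: gr_ext => n; apply: scalerA. Qed.
Fact gr_scale1 : left_id 1 gscale.
Proof. by move=> *; apply: gr_ext => n; apply: scale1r. Qed.
Fact gr_scaleDr : right_distributive gscale +%R.
Proof. by move=> *; apply: gr_ext => n; apply: scalerDr. Qed.
Fact gr_scaleDl x : {morph gscale^~ x : a b / a + b}.
Proof. by move=> *; apply: gr_ext => n; apply: scalerDl. Qed.
HB.instance Definition _ := GRing.Zmodule_isLmodule.Build rat (gr M)
  gr_scaleA gr_scale1 gr_scaleDr gr_scaleDl.

Lemma gr0E n : (0 : gr M) n = 0. Proof. by []. Qed.
Lemma grDE x y n : (x + y) n = x n + y n. Proof. by []. Qed.
Lemma grNE x n : (- x) n = - x n. Proof. by []. Qed.
Lemma grBE x y n : (x - y) n = x n - y n. Proof. by []. Qed.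
Lemma grZE a x n : (a *: x) n = a *: x n. Proof. by []. Qed.
Lemma gr_sumE I (r : seq I) (C : pred I) (F : I -> gr M) n :
  (\sum_(i <- r | C i) F i) n = \sum_(i <- r | C i) F i n.
Proof. exact: (big_morph (fun x : gr M => x n)). Qed.
Definition grE := (gr0E, grDE, grNE, grZE, gr_sumE).

Definition single k (a : M k) : gr M := fun n =>
  if @eqP nat k n is ReflectT e then ecast i (M i) e a else 0.

Lemma singleE k (a : M k) : single a k = a.
Proof.
by rewrite /single; case: eqP => // e; rewrite (eq_irrelevance e erefl).
Qed.

Lemma single_neq k (a : M k) n : k != n -> single a n = 0.
Proof. by rewrite /single; case: eqP. Qed.

Lemma single_eqP k (a : M k) x :
  x k = a -> (forall n, k != n -> x n = 0) -> x = single a.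
Proof.
move=> xk x0; apply: gr_ext => n; case: (eqVneq k n) => [<-|ne].
  by rewrite singleE.
by rewrite single_neq // x0.
Qed.

Fact single_linear k : linear (@single k).
Proof.
move=> c a b; apply: gr_ext => n; rewrite !grE.
case: (eqVneq k n) => [<-|ne]; first by rewrite !singleE.
by rewrite !single_neq // scaler0 addr0.
Qed.
HB.instance Definition _ k :=
  GRing.isLinear.Build rat (M k) (gr M) _ (@single k) (@single_linear k).

End Graded.

Section Operators.
Variable P : cyclicModule.
Implicit Types x y : gr P.

(* The letters of a word of degree n are numbered from 0 to n.  gR inserts a  *)
(* unit in front, and gd i multiplies the letters i and i + 1; it is 0 on     *)
(* words in which the letter i has no successor.                              *)
Definition gsgn x : gr P := fun n => (-1) ^+ n *: x n.
Definition gtau x : gr P := fun n => (-1) ^+ n *: cyc P n (x n).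
Definition gtaun i x : gr P := iter i gtau x.
Definition gT x : gr P := locked (x - gtau x).
Definition gR x : gr P :=
  fun n => if n is n'.+1 then cyc P n'.+1 (degen P n' n' (x n')) else 0.
Definition gd i x : gr P :=
  fun n => if (i <= n)%N then face P n i (x n.+1) else 0.
Definition gb x : gr P := fun n => cyc_b (x n.+1).
Definition gb' x : gr P :=
  fun n => \sum_(i < n.+1) (-1) ^+ i *: face P n i (x n.+1).
Definition gN x : gr P := fun n => \sum_(i < n.+1) gtaun i x n.
Definition gB x : gr P := gT (gR (gN x)).

Fact gsgn_linear : linear gsgn.
Proof.
move=> a x y; apply: gr_ext => n; rewrite !grE /gsgn !grE scalerDr !scalerA.
by rewrite mulrC.
Qed.
HB.instance Definition _ :=
  GRing.isLinear.Build rat (gr P) (gr P) _ gsgn gsgn_linear.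

Fact gtau_linear : linear gtau.
Proof.
move=> a x y; apply: gr_ext => n; rewrite !grE /gtau !grE linearP scalerDr.
by rewrite !scalerA mulrC.
Qed.
HB.instance Definition _ :=
  GRing.isLinear.Build rat (gr P) (gr P) _ gtau gtau_linear.

Fact gtaun_linear i : linear (gtaun i).
Proof. by move=> a x y; elim: i => //= i ->; rewrite linearP. Qed.
HB.instance Definition _ i :=
  GRing.isLinear.Build rat (gr P) (gr P) _ (gtaun i) (gtaun_linear i).

Fact gT_linear : linear gT.
Proof.
by move=> a x y; rewrite /gT -!lock linearP scalerBr opprD addrACA.
Qed.
HB.instance Definition _ :=
  GRing.isLinear.Build rat (gr P) (gr P) _ gT gT_linear.

Fact gR_linear : linear gR.
Proof.
move=> a x y; apply: gr_ext => -[|n]; rewrite !grE /gR ?grE ?linearP //.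
by rewrite scaler0 addr0.
Qed.
HB.instance Definition _ :=
  GRing.isLinear.Build rat (gr P) (gr P) _ gR gR_linear.

Fact gd_linear i : linear (gd i).
Proof.
move=> a x y; apply: gr_ext => n; rewrite !grE /gd; case: ifP; rewrite ?linearP //.
by rewrite scaler0 addr0.
Qed.
HB.instance Definition _ i :=
  GRing.isLinear.Build rat (gr P) (gr P) _ (gd i) (gd_linear i).

Fact gb_linear : linear gb.
Proof. by move=> a x y; apply: gr_ext => n; rewrite !grE /gb linearP. Qed.
HB.instance Definition _ :=
  GRing.isLinear.Build rat (gr P) (gr P) _ gb gb_linear.

Fact gb'_linear : linear gb'.
Proof.
move=> a x y; apply: gr_ext => n; rewrite !grE /gb' scaler_sumr -big_split.
by apply: eq_bigr => i _ /=; rewrite linearP scalerDr !scalerA mulrC.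
Qed.
HB.instance Definition _ :=
  GRing.isLinear.Build rat (gr P) (gr P) _ gb' gb'_linear.

Fact gN_linear : linear gN.
Proof.
move=> a x y; apply: gr_ext => n; rewrite !grE /gN scaler_sumr -big_split.
by apply: eq_bigr => i _ /=; rewrite linearP !grE.
Qed.
HB.instance Definition _ :=
  GRing.isLinear.Build rat (gr P) (gr P) _ gN gN_linear.

Fact gB_linear : linear gB.
Proof. by move=> a x y; rewrite /gB !linearP. Qed.
HB.instance Definition _ :=
  GRing.isLinear.Build rat (gr P) (gr P) _ gB gB_linear.
End Operators.

Arguments gsgn : simpl never.
Arguments gtau : simpl never.
Arguments gtaun : simpl never.
Arguments gT : simpl never.
Arguments gR : simpl never.
Arguments gd : simpl never.
Arguments gb : simpl never.
Arguments gb' : simpl never.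
Arguments gN : simpl never.
Arguments gB : simpl never.

(** * Relations between the operators of one cyclic module *)

Lemma bump0 i : bump 0 i = i.+1. Proof. by []. Qed.

Lemma sgn_add2 (V : lmodType rat) n (v : V) :
  (-1) ^+ n *: ((-1) ^+ n *: v) = v.
Proof. by rewrite scalerA -expr2 sqrr_sign scale1r. Qed.

(** The cancellation behind b b = 0: the simplicial identity exchanges the pairs
    (i, j) and (j.-1, i), whose signs are opposite. *)
Lemma alt_sum_swap (V : lmodType rat) N (F : nat -> nat -> V) :
  (forall i j, (i < j <= N)%N -> F i j = F j.-1 i) ->
  \sum_(i < N) \sum_(j < N.+1) (-1) ^+ (i + j) *: F i j = 0.
Proof.
move=> FE.
under eq_bigr => i _ do rewrite (bigID (fun j : 'I_N.+1 => (j <= i)%N)) /=.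
rewrite big_split /=.
under [X in _ + X]eq_bigr => i _ do rewrite big_mkcond big_ord_recl /= add0r.
rewrite [X in _ + X]exchange_big /= -big_split big1 // => i _ /=.
rewrite big_mkcond big_ord_recr /= leqNgt ltn_ord /= addr0 -big_split big1 //=.
move=> j _; rewrite -ltnNge ltnS; case: leqP => ij; last by rewrite addr0.
rewrite bump0 (FE j) /=; last by rewrite ltnS ij /=.
by rewrite addnS exprS mulN1r scaleNr addnC addrN.
Qed.

Section Relations.
Variable P : cyclicModule.
Implicit Types x y : gr P.

Local Notation s := (@gsgn P).
Local Notation tau := (@gtau P).
Local Notation T := (@gT P).
Local Notation r := (@gR P).
Local Notation d := (@gd P).
Local Notation b := (@gb P).
Local Notation b' := (@gb' P).
Local Notation N := (@gN P).
Local Notation B := (@gB P).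

Lemma gbE x n : b x n = \sum_(i < n.+2) (-1) ^+ i *: face P n i (x n.+1).
Proof. by []. Qed.

Lemma gb'E x n : b' x n = \sum_(i < n.+1) (-1) ^+ i *: face P n i (x n.+1).
Proof. by []. Qed.

Lemma gdE x n i : (i <= n)%N -> d i x n = face P n i (x n.+1).
Proof. by rewrite /gd => ->. Qed.

Lemma gd_out x n i : (n < i)%N -> d i x n = 0.
Proof. by rewrite ltnNge /gd => /negbTE ->. Qed.

Lemma gNE x n : N x n = \sum_(i < n.+1) gtaun i x n.
Proof. by []. Qed.

Lemma gtauE x n : tau x n = (-1) ^+ n *: cyc P n (x n). Proof. by []. Qed.

Lemma gtaunS i x : gtaun i.+1 x = tau (gtaun i x). Proof. by []. Qed.
Lemma gtaunSr i x : gtaun i.+1 x = gtaun i (tau x).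
Proof. by elim: i => // i IH; rewrite gtaunS IH. Qed.

Lemma gtaunE i x n : gtaun i x n = (-1) ^+ (n * i) *: iter i (cyc P n) (x n).
Proof.
elim: i => [|i IH]; first by rewrite muln0 scale1r.
by rewrite gtaunS gtauE IH linearZ scalerA -exprD mulnS.
Qed.

Lemma gtaun_deg x n : gtaun n.+1 x n = x n.
Proof.
by rewrite gtaunE cyc_order mulnS mulnn -signr_odd oddD oddX addbb scale1r.
Qed.

(** The last face multiplies the last letter by the first; rotating the word
    turns it into d_0. *)
Lemma gbb' x : b x = b' x + d 0 (tau x).
Proof.
apply: gr_ext => n; rewrite grE gb'E gbE big_ord_recr /=; congr (_ + _).
by rewrite gdE // linearZ /= face0_cyc.
Qed.

Lemma face_taul x n i : (i <= n)%N ->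
  face P n i.+1 (tau x n.+1) = - ((-1) ^+ n *: cyc P n (face P n i (x n.+1))).
Proof.
by move=> le_in; rewrite linearZ /= face_cyc // exprS mulN1r scaleNr.
Qed.

(** Rotation shifts the number of a face by one, so the faces of b' go to the
    faces of b other than d_0. *)
Lemma gb_tau x : b (tau x) = d 0 (tau x) + tau (b' x).
Proof.
apply: gr_ext => n; rewrite grE gbE [X in _ + X]gtauE gb'E big_ord_recl /= scale1r gdE //.
congr (_ + _); rewrite !linear_sum /=; apply: eq_bigr => i _.
rewrite bump0 face_taul ?leq_ord // exprS mulN1r scaleNr scalerN opprK.
by rewrite !linearZ /= !scalerA mulrC.
Qed.

Lemma gTE x : T x = x - tau x. Proof. by rewrite /gT -lock. Qed.

Lemma gb_T x : b (T x) = T (b' x).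
Proof.
rewrite !gTE linearB /= gb_tau.
by rewrite gbb' opprD addrA addrK.
Qed.

Lemma gRS x n : r x n.+1 = cyc P n.+1 (degen P n n (x n)). Proof. by []. Qed.

Lemma face0_r x n : face P n 0 (r x n.+1) = x n.
Proof. by rewrite gRS face0_cyc face_degen_succ. Qed.
Lemma faceS_r x n i : (i <= n)%N ->
  face P n.+1 i.+1 (r x n.+2) = cyc P n.+1 (degen P n n (face P n i (x n.+1))).
Proof.
by move=> le_in; rewrite gRS face_cyc ?face_degen_lt //=; lia.
Qed.
Lemma face_last_r x n : face P n n.+1 (r x n.+1) = cyc P n (x n).
Proof. by rewrite gRS face_cyc ?face_degen_eq //=; lia. Qed.

Lemma gd0_r x : d 0 (r x) = x.
Proof. by apply: gr_ext => n; rewrite gdE // face0_r. Qed.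

(** Inserting a unit in front is a contracting homotopy for b': only d_0
    removes the unit again. *)
Lemma gb'_r x : b' (r x) = x - r (b' x).
Proof.
apply: gr_ext => -[|n]; rewrite !grE gb'E.
  by rewrite big_ord1 scale1r face0_r oppr0 addr0.
rewrite big_ord_recl scale1r face0_r; congr (_ + _).
rewrite [in RHS]gRS gb'E !linear_sum /=; apply: eq_bigr => i _.
rewrite bump0 faceS_r ?leq_ord // !linearZ /=.
by rewrite exprS mulN1r scaleNr scalerN.
Qed.

(** The last face of R x is the rotation of x, which turns 1 into T. *)
Lemma gb_r x : b (r x) = T x - r (b' x).
Proof.
rewrite gbb' gb'_r gTE addrAC; congr (_ + _); congr (_ + _).
apply: gr_ext => n; rewrite gdE // grNE !gtauE linearZ /= face0_cyc face_last_r.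
by rewrite exprS mulN1r scaleNr.
Qed.

Lemma gb_b x : b (b x) = 0.
Proof.
apply: gr_ext => n; rewrite gbE gr0E.
under eq_bigr => i _.
  rewrite gbE linear_sum scaler_sumr.
  under eq_bigr => j _ do rewrite linearZ /= scalerA -exprD.
  over.
apply: (alt_sum_swap (F := fun i j => face P n i (face P n.+1 j (x n.+2)))).
by move=> i j ij; rewrite face_face.
Qed.

Lemma gb'_b' x : b' (b' x) = 0.
Proof.
apply: gr_ext => n; rewrite gb'E gr0E.
under eq_bigr => i _.
  rewrite gb'E linear_sum scaler_sumr.
  under eq_bigr => j _ do rewrite linearZ /= scalerA -exprD.
  over.
apply: (alt_sum_swap (F := fun i j => face P n i (face P n.+1 j (x n.+2)))).
by move=> i j ij; rewrite face_face //; lia.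
Qed.

Lemma gN_shift x n : \sum_(i < n.+1) gtaun i.+1 x n = N x n.
Proof. by rewrite gNE big_ord_recr big_ord_recl gtaun_deg addrC. Qed.

Lemma gT_N x : T (N x) = 0.
Proof.
apply: gr_ext => n; apply/eqP; rewrite gTE subr_eq0 -gN_shift.
apply/eqP; rewrite gtauE gNE linear_sum scaler_sumr.
by apply: eq_bigr => i _; rewrite gtaunS gtauE.
Qed.

Lemma gtau_N x : tau (N x) = N x.
Proof. by have /eqP := gT_N x; rewrite gTE subr_eq0 => /eqP <-. Qed.

Lemma gN_T x : N (T x) = 0.
Proof.
apply: gr_ext => n; apply/eqP; rewrite gTE linearB /= subr_eq0.
rewrite -gN_shift gNE; apply/eqP/eq_bigr => i _; by rewrite gtaunSr.
Qed.

Lemma gtaun_congr i x y n : x n = y n -> gtaun i x n = gtaun i y n.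
Proof. by rewrite !gtaunE => ->. Qed.

(** The signed face, with the sign chosen so that it commutes with tau up to a
    shift of its number. *)
Definition sface k x : gr P := fun n => (-1) ^+ k *: face P n k (x n.+1).

Lemma sface_tauS k x n : (k <= n)%N ->
  sface k.+1 (tau x) n = tau (sface k x) n.
Proof.
move=> kn; rewrite /sface face_taul // exprS mulN1r scaleNr scalerN opprK.
by rewrite gtauE !linearZ /= linearZ.
Qed.

Lemma sface_tau0 x n : sface 0 (tau x) n = sface n.+1 x n.
Proof. by rewrite /sface linearZ /= face0_cyc scale1r. Qed.

Lemma sface_le k i x n : (i <= k <= n.+1)%N ->
  sface k (gtaun i x) n = gtaun i (sface (k - i) x) n.
Proof.
elim: i k => [|i IH] k; first by rewrite subn0.
case: k => // k /andP[ik kn]; rewrite gtaunS sface_tauS //.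
rewrite gtauE IH ?subSS /= ?gtauE //; lia.
Qed.

Lemma sface_gt k i x n : (k < i)%N -> (i <= n.+1)%N ->
  sface k (gtaun i x) n = gtaun i.-1 (sface (n.+2 + k - i) x) n.
Proof.
elim: k i => [|k IH] [|i] //; rewrite ltnS.
  move=> _ iN; rewrite sface_tau0 sface_le; last by lia.
  by rewrite addn0 subSS.
move=> ki iN; rewrite gtaunS sface_tauS; last by lia.
rewrite gtauE IH ?leq_ord //; last by lia.
by case: i ki iN => // i _ _; rewrite addnS subSS [RHS]gtauE.
Qed.

(** Write k for the face and i for the exponent of the rotation.  A face of
    tau^i x with k < i merges a letter that was rotated to the front with its
    successor, which leaves a rotation by i.-1 only; for i <= k the exponent is kept.  Every pair
    (exponent, face of b) is reached exactly once.  The cyclic shuffle restricts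
    the exponents of rotations, and the weight a carries this restriction. *)
Lemma weighted_gb'_gN (a : nat -> rat) x n :
  \sum_(k < n.+1) \sum_(i < n.+2)
      a (if (i <= k)%N then i : nat else i.-1) *: sface k (gtaun i x) n =
  \sum_(i < n.+1) a i *: gtaun i (b x) n.
Proof.
pose G i l := a i *: gtaun i (sface l x) n.
have step (k : 'I_n.+1) : \sum_(i < n.+2)
      a (if (i <= k)%N then i : nat else i.-1) *: sface k (gtaun i x) n =
    \sum_(i < n.+1) ((if (i <= k)%N then G i (k - i)%N else 0)
                     + (if (k <= i)%N then G i (n.+1 + k - i)%N else 0)).
  rewrite big_split /= (bigID (fun i : 'I_n.+2 => (i <= k)%N)) /=.
  congr (_ + _); rewrite big_mkcond.
    rewrite big_ord_recr /= leqNgt ltn_ord addr0; apply: eq_bigr => i _ /=.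
    by case: leqP => // ik; rewrite sface_le ?ik //=; have := ltn_ord k; lia.
  rewrite big_ord_recl /= add0r; apply: eq_bigr => i _ /=.
  rewrite bump0 add0n -ltnNge ltnS; case: leqP => // ik.
  by rewrite sface_gt //= addSn subSS.
under eq_bigr => k _ do rewrite step.
rewrite exchange_big; apply: eq_bigr => i _ /=.
have lin : gtaun i (b x) n = \sum_(l < n.+2) gtaun i (sface l x) n.
  rewrite (gtaun_congr _ (y := \sum_(l < n.+2) sface l x)).
    by rewrite linear_sum gr_sumE.
  by rewrite gr_sumE.
rewrite lin scaler_sumr big_split /= -(big_mkord xpredT (fun l => G i l)).
rewrite (big_cat_nat (n := n.+1 - i)) //=; last by lia.
have := ltn_ord i => iN; congr (_ + _).
  rewrite -big_mkcond /= -(big_mkord (fun k => i <= k)%N (fun k => G i (k - i)%N)).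
  rewrite (big_cat_nat (n := i)) //=; last by lia.
  rewrite big1_seq ?add0r => [|k]; last first.
    by rewrite mem_index_iota => /andP[]; lia.
  rewrite -{1}[i : nat]add0n big_addn big_nat_cond [RHS]big_nat_cond.
  apply: eq_big => k; first by rewrite leq_addl andbT.
  by rewrite addnK.
rewrite -big_mkcond /=.
rewrite -(big_mkord (fun k => k <= i)%N (fun k => G i (n.+1 + k - i)%N)).
rewrite (big_cat_nat (n := i.+1)) //=.
rewrite [X in _ + X]big1_seq ?addr0 => [|k]; last first.
  by rewrite mem_index_iota => /andP[]; lia.
rewrite -[X in \big[_/_]_(X <= _ < _) _]add0n big_addn.
rewrite [X in \big[_/_]_(_ <= _ < X) _](_ : _ = i.+1); last by lia.
rewrite big_nat_cond [RHS]big_nat_cond.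
apply: eq_big => k; first by lia.
by move=> /andP[/andP[_ ki] _]; congr (G _ _); lia.
Qed.

Lemma gb'_N x : b' (N x) = N (b x).
Proof.
apply: gr_ext => n; have := weighted_gb'_gN (fun=> 1) x n.
under [RHS]eq_bigr do rewrite scale1r.
rewrite -gNE => <-; rewrite gb'E; apply: eq_bigr => k _.
rewrite gNE linear_sum scaler_sumr; apply: eq_bigr => i _.
by rewrite scale1r.
Qed.

Lemma gBE x : B x = T (r (N x)). Proof. by []. Qed.

Lemma gb_B x : b (B x) = - B (b x).
Proof.
by rewrite !gBE gb_T gb'_r gb'_N linearB /= gT_N sub0r.
Qed.

Lemma gB_B x : B (B x) = 0.
Proof. by rewrite !gBE gN_T !linear0. Qed.

(** Both terms R N x and - tau R N x of B x are sent to N x by d_0, the second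
    one because its first two letters are the last letter of N x and the unit,
    and N x is invariant under tau. *)
Lemma gd0_B x : d 0 (B x) = N x + N x.
Proof.
rewrite gBE gTE linearB /= gd0_r; congr (_ + _).
apply: gr_ext => n; rewrite !grE gdE // gtauE linearZ /= face0_cyc face_last_r.
by rewrite -[in RHS]gtau_N gtauE exprS mulN1r scaleNr opprK.
Qed.

(** The factor 1/2 compensates d_0 B = 2 N; it is the only place where the
    coefficients have to be rational. *)
Definition gomega x : gr P := 2%:R^-1 *: r (d 0 x).
Fact gomega_linear : linear gomega.
Proof.
move=> a x y; rewrite /gomega [d 0 _]linearP /= [r _]linearP /= scalerDr !scalerA.
by rewrite mulrC.
Qed.
HB.instance Definition _ :=
  GRing.isLinear.Build rat (gr P) (gr P) _ gomega gomega_linear.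

(** As a commutator with the differentials, kappa anticommutes with them; and
    omega B = R N together with b' R + R b' = 1 gives kappa B = N. *)
Definition gkappa x : gr P := locked (b' (gomega x) - gomega (b x)).
Lemma gkappaE x : gkappa x = b' (gomega x) - gomega (b x).
Proof. by rewrite /gkappa -lock. Qed.
Fact gkappa_linear : linear gkappa.
Proof.
move=> a x y; rewrite !gkappaE [gomega (_ + _)]linearP [b' _]linearP /=.
by rewrite [b _]linearP [gomega (_ + _)]linearP /= scalerBr opprD addrACA.
Qed.
HB.instance Definition _ :=
  GRing.isLinear.Build rat (gr P) (gr P) _ gkappa gkappa_linear.
Local Notation kappa := gkappa.

Lemma gkappa_b x : kappa (b x) = - b' (kappa x).
Proof.
rewrite !gkappaE linearB /= gb'_b' gb_b linear0 subr0 sub0r.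
by rewrite opprK.
Qed.

Lemma gomega_B x : gomega (B x) = r (N x).
Proof.
by rewrite /gomega gd0_B linearD /= -mulr2n -scaler_nat scalerA mulVf // scale1r.
Qed.

Lemma gkappa_B x : kappa (B x) = N x.
Proof.
rewrite gkappaE gb_B gomega_B gb'_r gb'_N.
suff -> : gomega (- B (b x)) = - r (N (b x)) by rewrite opprK subrK.
by rewrite linearN /= gomega_B.
Qed.

(** kappa B = N makes pi vanish on B = T R N, while N pi = N since N T = 0. *)
Definition gpi x : gr P := locked (x - T (r (kappa x))).
Lemma gpiE x : gpi x = x - T (r (kappa x)).
Proof. by rewrite /gpi -lock. Qed.
(** The homotopy between rho and the identity. *)
Definition glambda x : gr P := r (r (kappa x)).
(** Unlike pi this is homotopic to the identity, and it sends B x to R N x, the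
    term that occurs in T C. *)
Definition grho x : gr P := locked (gpi x + r (kappa x)).
Lemma grhoD x : grho x = gpi x + r (kappa x).
Proof. by rewrite /grho -lock. Qed.

Fact gpi_linear : linear gpi.
Proof.
move=> a x y; rewrite !gpiE !linearP /=.
by rewrite scalerDr addrACA.
Qed.
HB.instance Definition _ :=
  GRing.isLinear.Build rat (gr P) (gr P) _ gpi gpi_linear.
Fact glambda_linear : linear glambda.
Proof. by move=> a x y; rewrite /glambda !linearP. Qed.
HB.instance Definition _ :=
  GRing.isLinear.Build rat (gr P) (gr P) _ glambda glambda_linear.
Fact grho_linear : linear grho.
Proof.
by move=> a x y; rewrite !grhoD !linearP /= [in RHS]scalerDr addrACA.
Qed.
HB.instance Definition _ :=
  GRing.isLinear.Build rat (gr P) (gr P) _ grho grho_linear.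

Lemma gpi_B x : gpi (B x) = 0.
Proof. by rewrite gpiE gkappa_B subrr. Qed.

Lemma gb_pi x : b (gpi x) = gpi (b x) - T (kappa x).
Proof.
rewrite !gpiE [b _]linearB /= gb_T gb'_r gkappa_b.
rewrite [T (kappa x - _)]linearB [r (- _)]linearN [T (- _)]linearN /=.
by rewrite opprB opprK addrA.
Qed.

Lemma gN_pi x : N (gpi x) = N x.
Proof. by rewrite gpiE linearB /= gN_T subr0. Qed.

Lemma grho_B x : grho (B x) = r (N x).
Proof. by rewrite grhoD gpi_B add0r gkappa_B. Qed.

Lemma gb_rr x : b (r (r x)) = T (r x) - r x + r (r (b' x)).
Proof. by rewrite gb_r gb'_r linearB /= opprB addrA addrAC. Qed.

Lemma grhoE x : grho x = x - (b (glambda x) + glambda (b x)).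
Proof.
rewrite grhoD gpiE /glambda gb_rr gkappa_b !linearN /= addrK.
by rewrite opprB addrA addrAC.
Qed.

Lemma gb_rho x : b (grho x) = grho (b x).
Proof.
by rewrite !grhoE !linearB !linearD /= !gb_b !linear0 add0r addr0.
Qed.

Lemma gsgnE x n : s x n = (-1) ^+ n *: x n. Proof. by []. Qed.

Lemma gsgnK x : s (s x) = x.
Proof. by apply: gr_ext => n; rewrite !gsgnE sgn_add2. Qed.

Lemma gsgn_tau x : s (tau x) = tau (s x).
Proof.
by apply: gr_ext => n; rewrite gsgnE !gtauE gsgnE [in RHS]linearZ.
Qed.

Lemma gsgn_T x : s (T x) = T (s x).
Proof. by rewrite !gTE linearB /= gsgn_tau. Qed.

Lemma gsgn_r x : s (r x) = - r (s x).
Proof.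
apply: gr_ext => -[|n]; rewrite gsgnE grNE ?scaler0 ?oppr0 //.
by rewrite !gRS gsgnE exprS mulN1r scaleNr [degen _ _ _ (_ *: _)]linearZ /=
  [cyc _ _ (_ *: _)]linearZ.
Qed.

Lemma gsgn_d i x : s (d i x) = - d i (s x).
Proof.
apply: gr_ext => n; rewrite gsgnE grNE; case: (leqP i n) => ni.
  by rewrite !gdE // gsgnE [face _ _ _ (_ *: _)]linearZ /= exprS mulN1r scaleNr opprK.
by rewrite !gd_out // scaler0 oppr0.
Qed.

Lemma gsgn_b' x : s (b' x) = - b' (s x).
Proof.
apply: gr_ext => n; rewrite gsgnE grNE !gb'E scaler_sumr -sumrN.
apply: eq_bigr => i _; rewrite gsgnE [face _ _ _ (_ *: _)]linearZ /=.
rewrite exprS mulN1r scaleNr scalerN opprK !scalerA.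
by rewrite mulrC.
Qed.

Lemma gsgn_b x : s (b x) = - b (s x).
Proof. by rewrite !gbb' linearD /= gsgn_b' gsgn_d gsgn_tau opprD. Qed.

Lemma gsgn_N x : s (N x) = N (s x).
Proof.
apply: gr_ext => n; rewrite gsgnE !gNE scaler_sumr; apply: eq_bigr => i _.
by rewrite -gsgnE; congr (_ n); elim: (i : nat) => // m IH;
   rewrite !gtaunS gsgn_tau IH.
Qed.

Lemma gsgn_B x : s (B x) = - B (s x).
Proof. by rewrite !gBE gsgn_T gsgn_r gsgn_N linearN. Qed.

Lemma gsgn_kappa x : s (kappa x) = - kappa (s x).
Proof.
have so y : s (gomega y) = gomega (s y).
  by rewrite /gomega [s _]linearZ /= gsgn_r gsgn_d [r (- _)]linearN opprK.
rewrite !gkappaE [s _]linearB /= gsgn_b' !so gsgn_b [gomega (- _)]linearN opprK.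
by rewrite opprB addrC.
Qed.

Lemma gsgn_pi x : s (gpi x) = gpi (s x).
Proof.
by rewrite !gpiE [s _]linearB /= gsgn_T gsgn_r gsgn_kappa [r (- _)]linearN opprK.
Qed.

Lemma gsgn_lambda x : s (glambda x) = - glambda (s x).
Proof.
by rewrite /glambda !gsgn_r gsgn_kappa [r (- kappa _)]linearN opprK.
Qed.

Lemma gsgn_rho x : s (grho x) = grho (s x).
Proof.
by rewrite !grhoD [s _]linearD /= gsgn_pi gsgn_r gsgn_kappa [r (- _)]linearN opprK.
Qed.
End Relations.

(** * Words with the letters of an element in prescribed slots *)

Notation trues := (count id).
Notation falses := (count negb).

Lemma size_trues (m : bitseq) : size m = (trues m + falses m)%N.
Proof. by rewrite -(count_predC id). Qed.

Section Masks.
Variable P : cyclicModule.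
Implicit Types (x y z : gr P) (m u v : bitseq).

Definition gt x : gr P := fun n => cyc P n (x n).
Fact gt_linear : linear gt.
Proof. by move=> a x y; apply: gr_ext => n; rewrite !grE /gt !grE linearP. Qed.
HB.instance Definition _ :=
  GRing.isLinear.Build rat (gr P) (gr P) _ gt gt_linear.

Definition gs i x : gr P := fun n =>
  if n is n'.+1 then if (i <= n')%N then degen P n' i (x n') else 0 else 0.
Fact gs_linear i : linear (gs i).
Proof.
move=> a x y; apply: gr_ext => -[|n]; rewrite !grE /gs ?scaler0 ?addr0 //.
by case: ifP; rewrite ?linearP ?scaler0 ?addr0.
Qed.
HB.instance Definition _ i :=
  GRing.isLinear.Build rat (gr P) (gr P) _ (gs i) (gs_linear i).

(** The insertion of a unit in front of the letter k; the case k = 0 is the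
    extra degeneracy. *)
Definition ins k x : gr P := if k is k'.+1 then gs k' x else gR x.
Fact ins_linear k : linear (ins k).
Proof. by move=> a x y; case: k => [|k]; rewrite /ins linearP. Qed.
HB.instance Definition _ k :=
  GRing.isLinear.Build rat (gr P) (gr P) _ (ins k) (ins_linear k).

(** Degrees are counted here by the number c = n + 1 of letters. *)
Definition with_slots c x : gr P := fun n => if n.+1 == c then x n else 0.
Fact with_slots_linear c : linear (with_slots c).
Proof.
move=> a x y; apply: gr_ext => n; rewrite !grE /with_slots; case: ifP => // _.
by rewrite scaler0 addr0.
Qed.
HB.instance Definition _ c :=
  GRing.isLinear.Build rat (gr P) (gr P) _ (with_slots c) (with_slots_linear c).

(** The slots before k are already filled; a false slot receives a unit. *)
Fixpoint place k m x : gr P :=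
  if m is a :: m' then place k.+1 m' (if a then x else ins k x) else x.
Fact place_linear k m : linear (place k m).
Proof.
move=> a x y; elim: m k x y => [|[] m IH] k x y //=; rewrite -IH //.
by rewrite linearP.
Qed.
HB.instance Definition _ k m :=
  GRing.isLinear.Build rat (gr P) (gr P) _ (place k m) (place_linear k m).

(** The true slots of m receive the letters of x in their order and the false
    slots receive units, so that only the component of x with as many letters
    as m has true slots can contribute. *)
Definition spread m x : gr P := place 0 m (with_slots (trues m) x).
Fact spread_linear m : linear (spread m).
Proof. by move=> a x y; rewrite /spread !linearP. Qed.
HB.instance Definition _ m :=
  GRing.isLinear.Build rat (gr P) (gr P) _ (spread m) (spread_linear m).

Definition homog c x := forall n, n.+1 != c -> x n = 0.

Lemma hom_with_slots c x : homog c (with_slots c x).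
Proof. by move=> n /negbTE nc; rewrite /with_slots nc. Qed.

Lemma hom_ins c k x : homog c x -> homog c.+1 (ins k x).
Proof.
move=> hx [|n]; case: k => [|k] //= nc; rewrite ?gRS ?/gs hx ?linear0 //.
by case: ifP.
Qed.

Lemma hom_place c k m x : homog c x -> homog (c + falses m)%N (place k m x).
Proof.
elim: m c k x => [|[] m IH] c k x hx /=; rewrite ?addn0 //; first exact: IH.
by rewrite addnA addn1; apply/IH/hom_ins.
Qed.

Lemma hom_spread m x : homog (size m) (spread m x).
Proof.
by rewrite -(count_predC id m); apply/hom_place/hom_with_slots.
Qed.

Lemma gt_with_slots c x : gt (with_slots c x) = with_slots c (gt x).
Proof.
by apply: gr_ext => n; rewrite /gt /with_slots; case: ifP => //; rewrite linear0.
Qed.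

Lemma gR_with_slots c x : gR (with_slots c x) = with_slots c.+1 (gR x).
Proof.
apply: gr_ext => -[|n]; rewrite /with_slots ?gRS ?eqSS; case: ifP => //.
by rewrite !linear0.
Qed.

Lemma gd_with_slots i c x : gd i (with_slots c.+1 x) = with_slots c (gd i x).
Proof.
apply: gr_ext => n; rewrite /with_slots /gd eqSS; case: (n.+1 == c); case: ifP => //.
by rewrite linear0.
Qed.

Lemma gR_ins k x : gR (ins k x) = ins k.+1 (gR x).
Proof.
apply: gr_ext => -[|[|n]] //=; first by case: k => [|k]; rewrite gRS /= !linear0.
case: k => [|k]; rewrite gRS /= ?gRS.
  by rewrite degen0_cyc degen_cyc ?leqnn //= degen_degen ?leqnn.
rewrite ltnS; case: leqP => kn; last by rewrite !linear0.
by rewrite degen_cyc //= (degen_degen (i := k) (j := n)) ?kn /=.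
Qed.

Lemma gt_ins c k x : homog c x -> (k < c)%N -> gt (ins k x) = ins k.+1 (gt x).
Proof.
move=> hx kc; apply: gr_ext => -[|n]; first by case: k kc => [|k] _; rewrite /gt !linear0.
rewrite /gt; case: (eqVneq n.+1 c) => [nc|nc]; last first.
  by rewrite (hom_ins _ hx) //= hx ?linear0 //; case: ifP; rewrite ?linear0.
case: k kc => [|k] kc /=; first by rewrite degen0_cyc.
have -> : (k < n)%N by lia.
by rewrite (ltnW (_ : (k < n)%N)) ?degen_cyc //=; lia.
Qed.

Lemma gt_ins_last c x : homog c x -> gt (ins c x) = gR x.
Proof.
move=> hx; apply: gr_ext => -[|n]; first by case: c {hx} => [|c]; rewrite /gt linear0.
rewrite gRS /gt; case: (eqVneq n.+1 c) => [nc|nc]; last first.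
  by rewrite (hom_ins _ hx) //= hx ?linear0 //.
by rewrite -nc /= leqnn.
Qed.

Lemma place_cat k u v x : place k (u ++ v) x = place (k + size u) v (place k u x).
Proof. by elim: u k x => [|a u IH] k x /=; rewrite ?addn0 // IH addSnnS. Qed.

Lemma gR_place k m x : gR (place k m x) = place k.+1 m (gR x).
Proof. by elim: m k x => // -[] m IH k x /=; rewrite IH // gR_ins. Qed.

Lemma gt_place k m x : homog (k + trues m).+1 x ->
  gt (place k m x) = place k.+1 m (gt x).
Proof.
elim: m k x => // -[] m IH k x /= hx; rewrite IH //.
- by move: hx; rewrite add1n addnS.
- by rewrite (gt_ins hx) //; lia.
by rewrite add0n in hx; rewrite addSn; apply: hom_ins.
Qed.

Lemma spread_rcons_true m x :
  gt (spread (rcons m true) x) = spread (true :: m) (gt x).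
Proof.
rewrite /spread -cats1 place_cat /= count_cat /= addn0 addn1 add1n.
by rewrite gt_place ?gt_with_slots //; apply: hom_with_slots.
Qed.

Lemma spread_rcons_false m x :
  gt (spread (rcons m false) x) = spread (false :: m) x.
Proof.
rewrite /spread -cats1 place_cat /= count_cat /= !addn0 add0n.
rewrite gt_ins_last ?gR_place // -[X in homog X _](count_predC id).
exact/hom_place/hom_with_slots.
Qed.

(** Rotation brings the last slot to the front; if it holds a letter, then this
    letter becomes the first letter of x. *)
Lemma spread_rcons a m x :
  gt (spread (rcons m a) x) = spread (a :: m) (iter a gt x).
Proof. by case: a; rewrite ?spread_rcons_true ?spread_rcons_false. Qed.

Lemma spread_true_r m x : spread (true :: m) (gR x) = spread (false :: m) x.
Proof. by rewrite /spread /= add1n add0n gR_with_slots. Qed.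

Lemma gR_spread m x : gR (spread m x) = spread (false :: m) x.
Proof. by rewrite /spread gR_place /= add0n. Qed.

Lemma gd_ins_gt i k x : (k < i)%N -> gd i (ins k x) = ins k (gd i.-1 x).
Proof.
case: i => // i ki; apply: gr_ext => -[|n].
  by rewrite gd_out //; case: k {ki} => [|k].
case: (leqP i n) => ni; last first.
  rewrite gd_out //; case: k {ki} => [|k] /=; rewrite ?gRS ?gd_out ?linear0 //.
  by case: ifP.
rewrite gdE //; case: k ki => [|k] ki /=.
  by rewrite faceS_r // gRS gdE.
have -> : (k <= n.+1)%N by lia.
have -> : (k <= n)%N by lia.
by rewrite face_degen_gt ?gdE //; lia.
Qed.

Lemma gd_ins_lt i k x : (i.+1 < k)%N -> gd i (ins k x) = ins k.-1 (gd i x).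
Proof.
case: k => // -[|k] //; rewrite !ltnS => ik; apply: gr_ext => -[|n] /=.
  by rewrite /gd /= linear0; case: ifP.
case: (leqP k n) => kn.
  rewrite !gdE; try lia.
  by rewrite /gs ltnS kn face_degen_lt //=; lia.
have kn' : (k < n.+1)%N = false by lia.
by rewrite /gd /gs kn' linear0; case: ifP.
Qed.

Lemma gd_ins_id c i x : homog c x -> (i < c)%N -> gd i (ins i x) = x.
Proof.
move=> hx ic; apply: gr_ext => n; case: (eqVneq n.+1 c) => nc; last first.
  by rewrite /gd (hom_ins _ hx) ?linear0 ?hx //; case: ifP.
rewrite gdE; last by lia.
case: i ic => [|i] ic /=; first by rewrite face0_r.
by rewrite (_ : (i <= n)%N) ?face_degen_succ //; lia.
Qed.

Lemma gd_ins_succ c i x : homog c x -> (i < c)%N -> gd i (ins i.+1 x) = x.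
Proof.
move=> hx ic; apply: gr_ext => n; case: (eqVneq n.+1 c) => nc; last first.
  by rewrite /gd (hom_ins _ hx) ?linear0 ?hx //; case: ifP.
rewrite gdE; last by lia.
by rewrite /= (_ : (i <= n)%N) ?face_degen_eq //; lia.
Qed.

Lemma gd_ins_succ_ins c i x : homog c x -> (i <= c)%N ->
  gd i (ins i.+1 (ins i x)) = ins i x.
Proof. by move=> hx ic; apply: (gd_ins_succ (hom_ins _ hx)). Qed.

#[local] Arguments ins : simpl never.

Lemma gd_place_lt i k m x : (i.+1 < k)%N ->
  gd i (place k m x) = place k.-1 m (gd i x).
Proof.
elim: m k x => // a m IH [|k] x //= ik; rewrite IH; last by lia.
by case: a => //; rewrite gd_ins_lt.
Qed.

Lemma gd_place_ge i k m x : (k + size m <= i)%N ->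
  gd i (place k m x) = place k m (gd (i - falses m) x).
Proof.
elim: m k x => [|[] m IH] k x /=; rewrite ?subn0 //.
  by move=> ki; rewrite IH //; lia.
move=> ki; rewrite IH; last by lia.
rewrite gd_ins_gt; last by have := count_size negb m; lia.
by rewrite add1n subnS.
Qed.

(** The two slots after u are merged: two letters are multiplied, a unit is
    absorbed by a letter, and two units become one. *)
Lemma gd_spread u a c v x :
  gd (size u) (spread (u ++ [:: a, c & v]) x) =
  spread (u ++ (a || c) :: v) (if a && c then gd (trues u) x else x).
Proof.
rewrite /spread !place_cat /= add0n gd_place_lt //=.
set w := place 0 u _.
have hw : homog (size u + a + c + trues v)%N w.
  rewrite (_ : _ + _ = trues (u ++ [:: a, c & v]) + falses u)%N.
    exact/hom_place/hom_with_slots.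
  by rewrite count_cat size_trues /=; case: a {w}; case: c; lia.
congr place; rewrite {}/w in hw *.
case: a hw; case: c => hw /=.
- rewrite gd_place_ge // -[size u](count_predC id) addnK.
  by rewrite !count_cat /= !add1n !addnS gd_with_slots.
- rewrite (gd_ins_succ hw); last by lia.
  by rewrite !count_cat.
- rewrite (gd_ins_id hw); last by lia.
  by rewrite !count_cat /= add0n.
- rewrite (gd_ins_succ_ins hw); last by lia.
  by rewrite !count_cat.
Qed.

Lemma spread_congr m x y :
  (forall n, n.+1 = trues m -> x n = y n) -> spread m x = spread m y.
Proof.
move=> xy; rewrite /spread; congr place; apply: gr_ext => n.
by rewrite /with_slots; case: eqP => // /xy.
Qed.

Lemma spread_sgn m x : spread m (gsgn x) = (-1) ^+ (trues m).+1 *: spread m x.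
Proof.
rewrite -linearZ; apply: spread_congr => n <-.
by rewrite gsgnE grZE !exprS !mulN1r opprK.
Qed.

Lemma spread_tau m x : spread m (gtau x) = (-1) ^+ (trues m).+1 *: spread m (gt x).
Proof.
rewrite -linearZ; apply: spread_congr => n <-.
by rewrite gtauE grZE !exprS !mulN1r opprK.
Qed.

Lemma spread_b' m x :
  spread m (gb' x) = \sum_(k < trues m) (-1) ^+ k *: spread m (gd k x).
Proof.
under eq_bigr do rewrite -linearZ.
rewrite -linear_sum; apply: spread_congr => n nm.
rewrite -nm gr_sumE gb'E; apply: eq_bigr => k _.
by rewrite grZE gdE // -ltnS.
Qed.

Lemma spread_N m x :
  spread m (gN x) = \sum_(k < trues m) spread m (gtaun k x).
Proof.
rewrite -linear_sum; apply: spread_congr => n nm.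
by rewrite -nm gr_sumE gNE.
Qed.

Lemma spread_tau_trues m x : spread m (gtaun (trues m) x) = spread m x.
Proof. by apply: spread_congr => n nm; rewrite -nm gtaun_deg. Qed.

Lemma gtau_hom n x : homog n.+1 x -> gtau x = (-1) ^+ n *: gt x.
Proof.
move=> hx; apply: gr_ext => k; rewrite gtauE grZE; case: (eqVneq k n) => [->|kn] //.
by rewrite /gt hx ?linear0 ?scaler0.
Qed.

End Masks.

(** * Sums over masks and over their cuts *)

Section MaskSums.
Implicit Types m u v : bitseq.

Fixpoint masks n : seq bitseq :=
  if n is n'.+1 then [seq true :: m | m <- masks n'] ++
                     [seq false :: m | m <- masks n'] else [:: [::]].

Definition flip m : bitseq := map negb m.

(** With true for the letters of x and false for those of y, this counts the
    pairs in which a letter of y comes before one of x: its parity is the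
    signature of the shuffle. *)
Fixpoint inversions m : nat :=
  if m is a :: m' then ((if a then 0 else trues m') + inversions m')%N else 0.

Lemma size_flip m : size (flip m) = size m. Proof. exact: size_map. Qed.
Lemma flip_cat u v : flip (u ++ v) = flip u ++ flip v. Proof. exact: map_cat. Qed.
Lemma flip_rcons m a : flip (rcons m a) = rcons (flip m) (~~ a).
Proof. exact: map_rcons. Qed.
Lemma trues_flip m : trues (flip m) = falses m.
Proof. by rewrite count_map. Qed.

Lemma inversions_cat u v :
  inversions (u ++ v) = (inversions u + inversions v + falses u * trues v)%N.
Proof. by elim: u => [|[] u IH] /=; rewrite ?IH ?count_cat; nia. Qed.

Lemma inversions_rcons m a : inversions (rcons m a) = (inversions m + falses m * a)%N.
Proof. by rewrite -cats1 inversions_cat /=; case: a; rewrite !addn0. Qed.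

Lemma size_masks n m : m \in masks n -> size m = n.
Proof.
elim: n m => [|n IH] m /=; first by rewrite inE => /eqP ->.
by rewrite mem_cat => /orP[] /mapP[m' /IH <- ->].
Qed.

Variable V : lmodType rat.
Implicit Types F : bitseq -> V.

Lemma masksS n F :
  \sum_(m <- masks n.+1) F m =
  \sum_(m <- masks n) F (true :: m) + \sum_(m <- masks n) F (false :: m).
Proof. by rewrite /= big_cat /= !big_map. Qed.

Local Arguments masks : simpl never.

Lemma masks0 F : \sum_(m <- masks 0) F m = F [::].
Proof. by rewrite big_seq1. Qed.

Lemma masks_cat i k F :
  \sum_(m <- masks (i + k)) F m =
  \sum_(u <- masks i) \sum_(v <- masks k) F (u ++ v).
Proof.
elim: i F => [|i IH] F; first by rewrite masks0.
by rewrite addSn !masksS !IH.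
Qed.

Lemma masks_rcons n F :
  \sum_(m <- masks n.+1) F m =
  \sum_(m <- masks n) F (rcons m true) + \sum_(m <- masks n) F (rcons m false).
Proof.
rewrite -addn1 masks_cat -big_split /=; apply: eq_bigr => m _.
by rewrite -!cats1 masksS !masks0.
Qed.

Lemma masks_split n s (F : bitseq -> bitseq -> V) : (s <= n)%N ->
  \sum_(m <- masks n) F (take s m) (drop s m) =
  \sum_(u <- masks s) \sum_(v <- masks (n - s)) F u v.
Proof.
move=> sn; rewrite -{1}(subnKC sn) masks_cat.
apply: eq_big_seq => u /size_masks <-; apply: eq_bigr => v _.
by rewrite take_size_cat ?drop_size_cat.
Qed.

(** A cut stands for a word with a distinguished slot, or with two slots that
    are merged by a face, between the slots of u and those of v. *)
Definition splits n (F : bitseq -> bitseq -> V) :=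
  \sum_(m <- masks n) \sum_(s < n.+1) F (take s m) (drop s m).

Lemma eq_splits n (F G : bitseq -> bitseq -> V) :
  (forall u v, (size u + size v)%N = n -> F u v = G u v) ->
  splits n F = splits n G.
Proof.
move=> FG; apply: eq_big_seq => m /size_masks sm; apply: eq_bigr => s _.
by apply: FG; rewrite -size_cat cat_take_drop.
Qed.

Lemma splitsE n (F : bitseq -> bitseq -> V) :
  splits n F = \sum_(s < n.+1) \sum_(u <- masks s) \sum_(v <- masks (n - s)) F u v.
Proof.
rewrite /splits exchange_big; apply: eq_bigr => s _.
by rewrite masks_split // -ltnS.
Qed.

Lemma splitsD n (F G : bitseq -> bitseq -> V) :
  splits n (fun u v => F u v + G u v) = splits n F + splits n G.
Proof.
by rewrite /splits -big_split; apply: eq_bigr => m _ /=; rewrite -big_split.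
Qed.

Lemma splitsN n (F : bitseq -> bitseq -> V) :
  splits n (fun u v => - F u v) = - splits n F.
Proof.
by rewrite /splits -sumrN; apply: eq_bigr => m _ /=; rewrite -sumrN.
Qed.

Lemma splits0 (F : bitseq -> bitseq -> V) : splits 0 F = F [::] [::].
Proof. by rewrite /splits masks0 big_ord1. Qed.

Lemma splits_cons n (F : bitseq -> bitseq -> V) :
  splits n.+1 F = \sum_(m <- masks n.+1) F [::] m +
    (splits n (fun u v => F (true :: u) v) + splits n (fun u v => F (false :: u) v)).
Proof.
rewrite /splits; under eq_bigr do rewrite big_ord_recl take0 drop0.
rewrite big_split; congr (_ + _).
by rewrite masksS.
Qed.

Lemma splits_rcons n (F : bitseq -> bitseq -> V) :
  splits n.+1 F = \sum_(m <- masks n.+1) F m [::] +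
    (splits n (fun u v => F u (rcons v true)) +
     splits n (fun u v => F u (rcons v false))).
Proof.
transitivity (\sum_(m <- masks n.+1)
    (\sum_(s < n.+1) F (take s m) (drop s m) + F m [::])).
  apply: eq_big_seq => m /size_masks sm.
  by rewrite big_ord_recr /= take_oversize ?drop_oversize ?sm.
rewrite big_split addrC /=; congr (_ + _).
rewrite masks_rcons; congr (_ + _); apply: eq_big_seq => m /size_masks sm;
  apply: eq_bigr => s _; have sn : (s <= size m)%N by rewrite sm -ltnS.
  by rewrite drop_rcons // -cats1 takel_cat.
by rewrite drop_rcons // -cats1 takel_cat.
Qed.

(** A mask with one of its true slots is determined by what precedes and what
    follows that slot. *)
Lemma slot_trues n (H : bitseq -> nat -> V) :
  \sum_(m <- masks n.+1) \sum_(k < trues m) H m k =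
  splits n (fun u v => H (u ++ true :: v) (trues u)).
Proof.
elim: n H => [|n IH] H.
  by rewrite splits0 masksS !masks0 /= big_ord0 addr0 big_ord1.
rewrite masksS /=; under eq_bigr do rewrite big_ord_recl.
rewrite big_split /= -addrA splits_cons; congr (_ + _).
congr (_ + _); first exact: (IH (fun m k => H (true :: m) k.+1)).
exact: (IH (fun m k => H (false :: m) k)).
Qed.

Lemma slot_falses n (H : bitseq -> nat -> V) :
  \sum_(m <- masks n.+1) \sum_(k < falses m) H m k =
  splits n (fun u v => H (u ++ false :: v) (falses u)).
Proof.
elim: n H => [|n IH] H.
  by rewrite splits0 masksS !masks0 /= big_ord0 add0r big_ord1.
rewrite masksS /=; under [X in _ + X]eq_bigr do rewrite big_ord_recl.
rewrite big_split /= addrCA splits_cons; congr (_ + _).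
congr (_ + _); first exact: (IH (fun m k => H (true :: m) k)).
exact: (IH (fun m k => H (false :: m) k.+1)).
Qed.

(** The number of true slots in front of the false slot number j; thus
    i < before j m says that the true slot i precedes the false slot j. *)
Fixpoint before j m : nat :=
  match m, j with
  | [::], _ => 0
  | true :: m', _ => (before j m').+1
  | false :: m', 0 => 0
  | false :: m', j'.+1 => before j' m'
  end.

Lemma before_le j m : (before j m <= trues m)%N.
Proof.
by elim: m j => [|[] m IH] [|j] //=; rewrite ?add1n ?ltnS ?add0n.
Qed.

Lemma before_cat j u v : before j (u ++ v) =
  if (j < falses u)%N then before j u else (trues u + before (j - falses u) v)%N.
Proof.
elim: u j => [|[] u IH] [|j] //=; rewrite ?IH ?add0n ?add1n ?ltnS ?subSS //.
- by rewrite sub0n; case: ltnP.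
- by case: ltnP.
Qed.

End MaskSums.
Arguments masks : simpl never.

(** * Shuffle words *)

(** Congruences modulo 2 are decided by trying all parities of the atoms. *)
Ltac parity :=
  rewrite /= ?(oddD, oddM, oddS) /=;
  repeat match goal with |- context [odd ?n] => case: (odd n) end.

Section Words.
Variables P Q : cyclicModule.
Local Notation Y := (cyc_prod P Q).
Implicit Types (x : gr P) (y : gr Q) (m u v : bitseq).

Definition gpure x y : gr Y := fun n => pure (x n) (y n).

Lemma gpurePl a x x' y : gpure (a *: x + x') y = a *: gpure x y + gpure x' y.
Proof. by apply: gr_ext => n; rewrite /gpure !grE; apply: linearPl. Qed.
Lemma gpurePr a x y y' : gpure x (a *: y + y') = a *: gpure x y + gpure x y'.
Proof. by apply: gr_ext => n; rewrite /gpure !grE; apply: linearPr. Qed.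

Lemma gpure_bilinear : bilinear_for *:%R *:%R gpure.
Proof. by split=> [y a x x'|x a y y'] /=; rewrite ?gpurePl ?gpurePr. Qed.
HB.instance Definition _ := bilinear_isBilinear.Build rat
  (gr P) (gr Q) (gr Y) *:%R *:%R gpure gpure_bilinear.

Lemma gpureZl a x y : gpure (a *: x) y = a *: gpure x y.
Proof. exact: linearZl_LR. Qed.
Lemma gpureZr a x y : gpure x (a *: y) = a *: gpure x y.
Proof. exact: linearZr_LR. Qed.

Lemma gpure_t x y : gt (gpure x y) = gpure (gt x) (gt y).
Proof. by apply: gr_ext => n; apply: tensor_map_pure. Qed.

Lemma pure0 (U V : lmodType rat) : pure (0 : U) (0 : V) = 0.
Proof. exact: linear0r. Qed.

Lemma gpure_d i x y : gd i (gpure x y) = gpure (gd i x) (gd i y).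
Proof.
apply: gr_ext => n; rewrite /gpure /gd; case: ifP => _; last by rewrite pure0.
exact: tensor_map_pure.
Qed.

Lemma gpure_R x y : gR (gpure x y) = gpure (gR x) (gR y).
Proof.
apply: gr_ext => -[|n]; rewrite /gpure /=; first by rewrite pure0.
by rewrite -!tensor_map_pure.
Qed.

(** The masks m1 and m2 need not be complementary: in faces of shuffles there
    are slots with letters of both elements and slots with two units. *)
Definition word (c : nat) m1 m2 x y : gr Y :=
  (-1) ^+ c *: gpure (spread m1 x) (spread m2 y).

Lemma word_bilinear c m1 m2 : bilinear_for *:%R *:%R (word c m1 m2).
Proof.
split=> [y a x x'|x a y y'] /=; rewrite /word linearP ?gpurePl ?gpurePr scalerDr;
  by rewrite !scalerA mulrC.
Qed.
HB.instance Definition _ c m1 m2 := bilinear_isBilinear.Build rat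
  (gr P) (gr Q) (gr Y) *:%R *:%R (word c m1 m2) (@word_bilinear c m1 m2).

Lemma wordPl c m1 m2 a x x' y :
  word c m1 m2 (a *: x + x') y = a *: word c m1 m2 x y + word c m1 m2 x' y.
Proof. exact: linearPl. Qed.
Lemma wordPr c m1 m2 a x y y' :
  word c m1 m2 x (a *: y + y') = a *: word c m1 m2 x y + word c m1 m2 x y'.
Proof. exact: linearPr. Qed.
Lemma wordDl c m1 m2 x x' y :
  word c m1 m2 (x + x') y = word c m1 m2 x y + word c m1 m2 x' y.
Proof. exact: linearDl. Qed.
Lemma wordBl c m1 m2 x x' y :
  word c m1 m2 (x - x') y = word c m1 m2 x y - word c m1 m2 x' y.
Proof. exact: linearBl. Qed.
Lemma wordBr c m1 m2 x y y' :
  word c m1 m2 x (y - y') = word c m1 m2 x y - word c m1 m2 x y'.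
Proof. exact: linearBr. Qed.
Lemma word_suml c m1 m2 I (r : seq I) (C : pred I) (F : I -> gr P) y :
  word c m1 m2 (\sum_(i <- r | C i) F i) y =
  \sum_(i <- r | C i) word c m1 m2 (F i) y.
Proof. exact: linear_sumlz. Qed.
Lemma word_sumr c m1 m2 I (r : seq I) (C : pred I) (F : I -> gr Q) x :
  word c m1 m2 x (\sum_(i <- r | C i) F i) =
  \sum_(i <- r | C i) word c m1 m2 x (F i).
Proof. exact: linear_sumr. Qed.
Lemma wordZl c m1 m2 a x y : word c m1 m2 (a *: x) y = a *: word c m1 m2 x y.
Proof. exact: linearZl_LR. Qed.
Lemma wordZr c m1 m2 a x y : word c m1 m2 x (a *: y) = a *: word c m1 m2 x y.
Proof. exact: linearZr_LR. Qed.

Lemma word_parity c c' m1 m2 x y : odd c = odd c' ->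
  word c m1 m2 x y = word c' m1 m2 x y.
Proof. by move=> cc'; rewrite /word -signr_odd cc' signr_odd. Qed.

Lemma sgn_word k c m1 m2 x y :
  (-1) ^+ k *: word c m1 m2 x y = word (k + c) m1 m2 x y.
Proof. by rewrite /word scalerA exprD. Qed.

Lemma word_sgnl c m1 m2 x y :
  word c m1 m2 (gsgn x) y = word (c + (trues m1).+1) m1 m2 x y.
Proof. by rewrite {1}/word spread_sgn gpureZl scalerA -exprD. Qed.

Lemma hom_word c m1 m2 x y : size m1 = size m2 -> homog (size m1) (word c m1 m2 x y).
Proof.
move=> s12 n ns; rewrite /word grZE /gpure (hom_spread x ns).
rewrite (hom_spread (m := m2)) -?s12 //.
by rewrite pure0 scaler0.
Qed.

Lemma spread_iter_t (R : cyclicModule) (a : bool) m (z : gr R) :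
  spread (a :: m) (iter a (@gt R) z) =
  (-1) ^+ (a * trues m) *: spread (a :: m) (gtaun a z).
Proof.
case: a => /=; last by rewrite mul0n scale1r.
by rewrite mul1n spread_tau scalerA -exprD -signr_odd oddD /= negbK addbb
  scale1r.
Qed.

Lemma tau_word c m1 m2 (a a' : bool) x y : size m1 = size m2 ->
  gtau (word c (rcons m1 a) (rcons m2 a') x y) =
  word (size m1 + a * trues m1 + a' * trues m2 + c) (a :: m1) (a' :: m2)
    (gtaun a x) (gtaun a' y).
Proof.
move=> s12; rewrite (@gtau_hom _ (size m1)); last first.
  by rewrite -(size_rcons m1 a); apply: hom_word; rewrite !size_rcons s12.
rewrite /word linearZ /= gpure_t !spread_rcons !spread_iter_t gpureZl gpureZr !scalerA.
by rewrite -!exprD; congr (_ ^+ _ *: _); lia.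
Qed.

Lemma gd_word c u u' (a b a' b' : bool) v v' x y : size u = size u' ->
  gd (size u) (word c (u ++ [:: a, b & v]) (u' ++ [:: a', b' & v']) x y) =
  word c (u ++ (a || b) :: v) (u' ++ (a' || b') :: v')
    (if a && b then gd (trues u) x else x)
    (if a' && b' then gd (trues u') y else y).
Proof. by move=> s12; rewrite /word linearZ /= gpure_d gd_spread {1}s12 gd_spread. Qed.

Lemma R_word c m1 m2 x y :
  gR (word c m1 m2 x y) = word c (false :: m1) (false :: m2) x y.
Proof. by rewrite /word linearZ /= gpure_R !gR_spread. Qed.

Definition sword m x y := word (inversions m) m (flip m) x y.
(** For empty u these are the words of the shuffle product, in which a_0 and b_0
    share the first slot; the others are rotations of these. *)
Definition oword u v x y :=
  word (inversions (u ++ v)) (u ++ true :: v) (flip u ++ true :: flip v) x y.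

Definition gsh n x y : gr Y := \sum_(m <- masks n) oword [::] m x y.
Definition gsh2 n x y : gr Y := \sum_(m <- masks n.+1) sword m x y.
(** In the rotation tau^i x the letter a_0 has number i.  The condition on i and
    j therefore says that the letter a_0 of x comes before the letter b_0 of
    y. *)
Definition gcsh n x y : gr Y :=
  \sum_(m <- masks n.+1) \sum_(i < trues m) \sum_(j < falses m | (i < before j m)%N)
     sword m (gtaun i x) (gtaun j y).

Lemma hom_sum c (R : cyclicModule) I (r : seq I) (C : pred I) (F : I -> gr R) :
  (forall i, C i -> homog c (F i)) -> homog c (\sum_(i <- r | C i) F i).
Proof.
by move=> hF n nc; rewrite gr_sumE big1 // => i Ci; apply: hF.
Qed.

Lemma hom_sum_masks n c (R : cyclicModule) (F : bitseq -> gr R) :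
  (forall m, size m = n -> homog c (F m)) -> homog c (\sum_(m <- masks n) F m).
Proof.
move=> hF; rewrite big_seq_cond; apply: hom_sum => m /andP[/size_masks sm _].
exact: hF.
Qed.

Lemma hom_sword m x y : homog (size m) (sword m x y).
Proof. by apply: hom_word; rewrite size_flip. Qed.

Lemma hom_oword u v x y : homog (size u + size v).+1 (oword u v x y).
Proof.
rewrite -addnS -[_.+1]/(size (true :: v)) -size_cat.
by apply: hom_word; rewrite !size_cat /= !size_flip.
Qed.

Lemma tau_sword a m x y :
  gtau (sword (rcons m a) x y) = sword (a :: m) (gtaun a x) (gtaun (~~ a) y).
Proof.
rewrite /sword flip_rcons tau_word ?size_flip //; apply: word_parity.
by rewrite inversions_rcons trues_flip size_trues; case: a; parity.
Qed.

Lemma tau_oword a u v x y :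
  gtau (oword u (rcons v a) x y) = oword (a :: u) v (gtaun a x) (gtaun (~~ a) y).
Proof.
rewrite /oword flip_rcons -!rcons_cons -!rcons_cat tau_word; last first.
  by rewrite !size_cat /= !size_flip.
rewrite /=; apply: word_parity.
by rewrite inversions_rcons size_cat !count_cat /= !trues_flip !size_trues;
  case: a; parity.
Qed.

End Words.

(** * The operators T and N on the cyclic shuffle *)

Lemma gtaun_telescope (R : cyclicModule) (z : gr R) k :
  \sum_(i < k) gtaun i (gT z) = z - gtaun k z.
Proof.
elim: k => [|k IH]; first by rewrite big_ord0 subrr.
by rewrite big_ord_recr /= IH gTE linearB /= -gtaunSr addrA subrK.
Qed.

Lemma gtaunD (R : cyclicModule) (z : gr R) i j :
  gtaun (i + j) z = gtaun i (gtaun j z).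
Proof. exact: iterD. Qed.

Section Identities.
Variables P Q : cyclicModule.
Local Notation Y := (cyc_prod P Q).
Implicit Types (x : gr P) (y : gr Q) (m u v : bitseq).

Lemma sword_suml m I (r : seq I) (C : pred I) (F : I -> gr P) y :
  sword m (\sum_(i <- r | C i) F i) y = \sum_(i <- r | C i) sword m (F i) y.
Proof. exact: word_suml. Qed.
Lemma sword_sumr m I (r : seq I) (C : pred I) (F : I -> gr Q) x :
  sword m x (\sum_(i <- r | C i) F i) = \sum_(i <- r | C i) sword m x (F i).
Proof. exact: word_sumr. Qed.

Lemma sword_Nl m x y : sword m (gN x) y = \sum_(i < trues m) sword m (gtaun i x) y.
Proof. by rewrite -sword_suml /sword /word spread_N linear_sum. Qed.

Lemma sword_Nr m x y : sword m x (gN y) = \sum_(j < falses m) sword m x (gtaun j y).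
Proof.
by rewrite -sword_sumr /sword /word spread_N trues_flip linear_sum.
Qed.

Lemma sword_tau_falses m k x y : k = falses m -> sword m x (gtaun k y) = sword m x y.
Proof. by move=> ->; rewrite /sword /word -trues_flip spread_tau_trues. Qed.

(** Cutting the word at the slot of b_0. *)
Lemma gcsh_falses n x y : gcsh n x y =
  splits n (fun u v => \sum_(i < trues u)
    sword (u ++ false :: v) (gtaun i x) (gtaun (falses u) y)).
Proof.
pose H m j := \sum_(i < before j m) sword m (gtaun i x) (gtaun j y).
have -> : gcsh n x y = \sum_(m <- masks n.+1) \sum_(j < falses m) H m j.
  apply: eq_bigr => m _; rewrite (exchange_big_dep xpredT) //=.
  apply: eq_bigr => j _; rewrite /H.
  rewrite (big_ord_widen _ (fun i => sword m (gtaun i x) (gtaun j y))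
             (before_le j m)).
  by apply: eq_bigl.
rewrite slot_falses; apply: eq_splits => u v _.
by rewrite /H before_cat ltnn subnn /= addn0.
Qed.

Lemma before_at_true j u v : (falses u <= j)%N = (trues u < before j (u ++ true :: v))%N.
Proof.
rewrite before_cat; case: (leqP (falses u) j) => uj /=.
  by rewrite addnS ltnS leq_addr.
by rewrite ltnNge before_le.
Qed.

(** Cutting the word at the slot of a_0. *)
Lemma gcsh_trues n x y : gcsh n x y =
  splits n (fun u v => \sum_(j < falses (u ++ v) | (falses u <= j)%N)
    sword (u ++ true :: v) (gtaun (trues u) x) (gtaun j y)).
Proof.
pose H m i := \sum_(j < falses m | (i < before j m)%N)
  sword m (gtaun i x) (gtaun j y).
rewrite [gcsh n x y](slot_trues n H); apply: eq_splits => u v _.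
rewrite /H !count_cat /=; apply: eq_bigl => j.
by rewrite -before_at_true.
Qed.

(** In these words, and in those of cut_trues, the rotations are such that u
    consists of the letters that were moved from the end of a word to its
    front: they are rotations of words whose first slot is the one between u
    and v. *)
Definition cut_falses n x y : gr Y := splits n (fun u v =>
  sword (u ++ false :: v) (gtaun (trues u) x) (gtaun (falses u) y)).
Definition cut_trues n x y : gr Y := splits n (fun u v =>
  sword (u ++ true :: v) (gtaun (trues u) x) (gtaun (falses u) y)).

Lemma sword_Bl m x x' y : sword m (x - x') y = sword m x y - sword m x' y.
Proof. exact: wordBl. Qed.
Lemma sword_Br m x y y' : sword m x (y - y') = sword m x y - sword m x y'.
Proof. exact: wordBr. Qed.

(** Cut at the slot of b_0, the sum over the rotations of T x telescopes. *)
Lemma gcsh_Tl n x y : gcsh n (gT x) y = gsh2 n x (gN y) - cut_falses n x y.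
Proof.
have -> : gsh2 n x (gN y) =
    splits n (fun u v => sword (u ++ false :: v) x (gtaun (falses u) y)).
  rewrite -(slot_falses n (fun m j => sword m x (gtaun j y))).
  by apply: eq_bigr => m _; rewrite sword_Nr.
rewrite gcsh_falses -splitsN -splitsD; apply: eq_splits => u v _.
by rewrite -sword_suml gtaun_telescope sword_Bl.
Qed.

Lemma gtaun_telescope_from (R : cyclicModule) (z : gr R) a k : (a <= k)%N ->
  \sum_(j < k | (a <= j)%N) gtaun j (gT z) = gtaun a z - gtaun k z.
Proof.
move=> ak; apply: (addIr (\sum_(j < a) gtaun j (gT z))).
rewrite {1}(big_ord_widen k (fun j => gtaun j (gT z)) ak).
have := gtaun_telescope z k; rewrite (bigID (fun j : 'I_k => a <= j)%N) /=.
under [X in _ + X]eq_bigl => j do rewrite -ltnNge.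
by move=> ->; rewrite gtaun_telescope [RHS]addrC addrA addrNK.
Qed.

Lemma gcsh_Tr n x y : gcsh n x (gT y) = cut_trues n x y - gsh2 n (gN x) y.
Proof.
have -> : gsh2 n (gN x) y =
    splits n (fun u v => sword (u ++ true :: v) (gtaun (trues u) x) y).
  rewrite -(slot_trues n (fun m i => sword m (gtaun i x) y)).
  by apply: eq_bigr => m _; rewrite sword_Nl.
rewrite gcsh_trues -splitsN -splitsD; apply: eq_splits => u v _.
rewrite -sword_sumr gtaun_telescope_from; last by rewrite count_cat leq_addr.
rewrite sword_Br; congr (_ - _).
by rewrite sword_tau_falses // !count_cat.
Qed.

Lemma wordS c m1 m2 x y : word c.+1 m1 m2 x y = - word c m1 m2 x y.
Proof. by rewrite /word exprS mulN1r scaleNr. Qed.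

Lemma oword_Rl m x y :
  oword [::] m (gR x) y = word (inversions m) (false :: m) (true :: flip m) x y.
Proof. by rewrite /oword /word /= spread_true_r. Qed.

Lemma oword_Rr m x y :
  oword [::] m x (gR y) = word (inversions m) (true :: m) (false :: flip m) x y.
Proof. by rewrite /oword /word /= spread_true_r. Qed.

Lemma sword_cons_false m x y :
  sword (false :: m) x y = - oword [::] m (gR (gsgn x)) y.
Proof.
rewrite oword_Rl word_sgnl -wordS; apply: word_parity.
by parity.
Qed.

Lemma sword_cons_true m x y : sword (true :: m) x y = oword [::] m x (gR y).
Proof. by rewrite oword_Rr. Qed.

Lemma gtau_splits n (F : bitseq -> bitseq -> gr Y) :
  gtau (splits n F) = splits n (fun u v => gtau (F u v)).
Proof.
by rewrite linear_sum; apply: eq_bigr => m _ /=; rewrite linear_sum.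
Qed.

(** The rotation of a word keeps a_0 in front of b_0 unless b_0 is in the last
    slot, and all words are obtained in this way except those that start with
    a_0.  So what remains of C - tau C are the words that start with a_0, minus
    the rotated words, which start with b_0. *)
Lemma gT_gcsh n x y :
  gT (gcsh n x y) = gsh n x (gR (gN y)) + gsh n (gR (gN (gsgn x))) y.
Proof.
have -> : gsh n x (gR (gN y)) = \sum_(m <- masks n) sword (true :: m) x (gN y).
  by apply: eq_bigr => m _; rewrite sword_cons_true.
have -> : gsh n (gR (gN (gsgn x))) y =
    - \sum_(m <- masks n) sword (false :: m) (gN x) y.
  rewrite -sumrN; apply: eq_bigr => m _.
  by rewrite sword_cons_false opprK gsgn_N.
rewrite gcsh_falses; case: n => [|n].
  rewrite !masks0 splits0 big_ord0 linear0 sword_Nr big_ord0.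
  by rewrite sword_Nl big_ord0 subrr.
pose G1 u v := \sum_(i < trues u)
  sword (true :: u ++ false :: v) (gtaun i.+1 x) (gtaun (falses u) y).
pose G0 u v := \sum_(i < trues u)
  sword (false :: u ++ false :: v) (gtaun i x) (gtaun (falses u).+1 y).
rewrite gTE {1}splits_cons gtau_splits splits_rcons.
have -> : splits n (fun u v => \sum_(i < trues (true :: u))
      sword ((true :: u) ++ false :: v) (gtaun i x)
        (gtaun (falses (true :: u)) y)) =
    \sum_(m <- masks n.+1) sword (true :: m) x (gN y) + splits n G1.
  have -> : \sum_(m <- masks n.+1) sword (true :: m) x (gN y) =
      splits n (fun u v => sword (true :: u ++ false :: v) x (gtaun (falses u) y)).
    rewrite -(slot_falses n (fun m j => sword (true :: m) x (gtaun j y))).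
    by apply: eq_bigr => m _; rewrite sword_Nr.
  by rewrite -splitsD; apply: eq_splits => u v _; rewrite big_ord_recl.
have -> : splits n (fun u v => \sum_(i < trues (false :: u))
      sword ((false :: u) ++ false :: v) (gtaun i x)
        (gtaun (falses (false :: u)) y)) = splits n G0.
  exact: eq_splits.
have -> : splits n (fun u v => gtau (\sum_(i < trues u)
      sword (u ++ false :: rcons v true) (gtaun i x)
        (gtaun (falses u) y))) = splits n G1.
  apply: eq_splits => u v _; rewrite linear_sum; apply: eq_bigr => i _ /=.
  by rewrite -rcons_cons -rcons_cat tau_sword.
have -> : splits n (fun u v => gtau (\sum_(i < trues u)
      sword (u ++ false :: rcons v false) (gtaun i x)
        (gtaun (falses u) y))) = splits n G0.
  apply: eq_splits => u v _; rewrite linear_sum; apply: eq_bigr => i _ /=.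
  by rewrite -rcons_cons -rcons_cat tau_sword.
have -> : \sum_(m <- masks n.+1) gtau (\sum_(i < trues m)
      sword (m ++ [:: false]) (gtaun i x) (gtaun (falses m) y)) =
    \sum_(m <- masks n.+1) sword (false :: m) (gN x) y.
  apply: eq_bigr => m _; rewrite linear_sum sword_Nl; apply: eq_bigr => i _ /=.
  by rewrite cats1 tau_sword -[gtaun (~~ _) _]gtaunD sword_tau_falses.
rewrite [X in X + _ - _](_ : _ = 0); last by apply: big1 => m _; rewrite big_ord0.
by rewrite add0r -[X in X - _]addrA [X in _ - X]addrC addrKA.
Qed.

(** Treats at the same time the words in which the slot between u and v holds
    letters of both elements or a letter of one of them; l1 and l2 tell
    which. *)
Definition rword (l1 l2 : bool) u v x y :=
  word (~~ l1 * trues u + ~~ l2 * falses u + inversions (u ++ v))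
    (u ++ l1 :: v) (flip u ++ l2 :: flip v) x y.

Lemma tau_rword l1 l2 a u v x y :
  gtau (rword l1 l2 u (rcons v a) x y) =
  rword l1 l2 (a :: u) v (gtaun a x) (gtaun (~~ a) y).
Proof.
rewrite /rword flip_rcons -!rcons_cons -!rcons_cat tau_word; last first.
  by rewrite !size_cat /= !size_flip.
rewrite /=; apply: word_parity.
rewrite inversions_rcons size_cat !count_cat /= !trues_flip !size_trues.
by case: a; case: l1; case: l2; parity.
Qed.

Lemma gtaun_rword l1 l2 u v x y :
  gtaun (size u) (rword l1 l2 [::] (v ++ u) x y) =
  rword l1 l2 u v (gtaun (trues u) x) (gtaun (falses u) y).
Proof.
elim: u v => [|a u IH] v; first by rewrite cats0.
by rewrite [LHS]gtaunS -cat_rcons IH tau_rword -!gtaunD.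
Qed.

Lemma gN_homog (R : cyclicModule) (z : gr R) n :
  homog n.+1 z -> gN z = \sum_(s < n.+1) gtaun s z.
Proof.
move=> hz; apply: gr_ext => k; rewrite gNE gr_sumE.
case: (eqVneq k n) => [->|kn] //.
have z0 s : gtaun s z k = 0.
  by rewrite (gtaun_congr _ (y := 0)) ?linear0 // hz.
by rewrite !big1 // => s _; apply: z0.
Qed.

Lemma homog_rword l1 l2 u v x y :
  homog (size u + size v).+1 (rword l1 l2 u v x y).
Proof.
rewrite -addnS -[_.+1]/(size (l1 :: v)) -size_cat.
by apply: hom_word; rewrite !size_cat /= !size_flip.
Qed.

(** The rotations of a word with a distinguished first slot correspond to the
    cuts of the remaining slots. *)
Lemma gN_rwords l1 l2 n x y :
  gN (\sum_(m <- masks n) rword l1 l2 [::] m x y) =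
  splits n (fun u v => rword l1 l2 u v (gtaun (trues u) x) (gtaun (falses u) y)).
Proof.
rewrite (@gN_homog _ _ n); last first.
  by apply: hom_sum_masks => m <-; apply: (@homog_rword l1 l2 [::]).
rewrite splitsE; apply: eq_bigr => s _; rewrite linear_sum /=.
have /subnK {1}<- : (s <= n)%N by rewrite -ltnS.
rewrite masks_cat exchange_big /=.
apply: eq_big_seq => u /size_masks su; apply: eq_bigr => v _.
by rewrite -su gtaun_rword.
Qed.

Lemma gN_gsh n x y : gN (gsh n x y) =
  splits n (fun u v => oword u v (gtaun (trues u) x) (gtaun (falses u) y)).
Proof. exact: (gN_rwords true true). Qed.

Lemma sword_sgnl m x y :
  sword m (gsgn x) y = word (inversions m + (trues m).+1) m (flip m) x y.
Proof. exact: word_sgnl. Qed.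

Lemma gN_gsh_Rl n x y : gN (gsh n (gR x) y) = - cut_falses n (gsgn x) y.
Proof.
have -> : gsh n (gR x) y = \sum_(m <- masks n) rword false true [::] m x y.
  by apply: eq_bigr => m _; rewrite oword_Rl.
rewrite gN_rwords -splitsN; apply: eq_splits => u v _.
have -> : gtaun (trues u) (gsgn x) = gsgn (gtaun (trues u) x).
  by elim: (trues u) => // k IH; rewrite !gtaunS IH gsgn_tau.
rewrite sword_sgnl -wordS /rword flip_cat; apply: word_parity.
by rewrite !inversions_cat !count_cat; parity.
Qed.

Lemma gN_gsh_Rr n x y : gN (gsh n x (gR y)) = cut_trues n x y.
Proof.
have -> : gsh n x (gR y) = \sum_(m <- masks n) rword true false [::] m x y.
  by apply: eq_bigr => m _; rewrite oword_Rr.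
rewrite gN_rwords; apply: eq_splits => u v _.
rewrite /sword /rword flip_cat; apply: word_parity.
by rewrite !inversions_cat; parity.
Qed.

Lemma gb'_homog (R : cyclicModule) (z : gr R) n : homog n.+2 z ->
  gb' z = \sum_(s < n.+1) (-1) ^+ s *: gd s z.
Proof.
move=> hz; apply: gr_ext => k; rewrite gb'E gr_sumE.
case: (eqVneq k n) => [->|kn].
  by apply: eq_bigr => s _; rewrite grZE gdE // leq_ord.
rewrite !big1 // => s _; rewrite ?grZE /gd hz ?linear0 ?scaler0 //.
by case: ifP; rewrite scaler0.
Qed.

(** A face only depends on the contents of the two slots that it merges, hence
    the terms are sorted by these contents and by the slots on both sides. *)
Lemma gb'_masks n (F : bitseq -> gr Y) :
  (forall m, size m = n.+2 -> homog n.+2 (F m)) ->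
  gb' (\sum_(m <- masks n.+2) F m) =
  splits n (fun u v => (-1) ^+ size u *: gd (size u)
    (F (u ++ [:: true, true & v]) + F (u ++ [:: true, false & v]) +
     (F (u ++ [:: false, true & v]) + F (u ++ [:: false, false & v])))).
Proof.
move=> hF; rewrite (@gb'_homog _ _ n); last exact: hom_sum_masks.
rewrite splitsE; apply: eq_bigr => s _.
have -> : n.+2 = (s + (n - s).+2)%N by rewrite !addnS subnKC // -ltnS.
rewrite masks_cat linear_sum scaler_sumr /=.
apply: eq_big_seq => u /size_masks su; rewrite su.
rewrite !masksS -!big_split linear_sum scaler_sumr.
by apply: eq_bigr.
Qed.

End Identities.

(** * Faces of the cyclic shuffle *)

Lemma sum_delta (V : lmodType rat) (F : nat -> nat -> V) a b k l :
  (a < k)%N -> (b < l)%N ->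
  \sum_(i < k) \sum_(j < l) ((i == a :> nat) && (j == b :> nat))%:R *: F i j =
  F a b.
Proof.
move=> ak bl; rewrite (bigD1 (Ordinal ak)) //= [X in _ + X]big1 ?addr0 => [|i ia].
  rewrite (bigD1 (Ordinal bl)) //= !eqxx scale1r big1 ?addr0 // => j jb.
  by rewrite (negbTE (_ : (j : nat) != b)) ?scale0r.
rewrite big1 // => j _.
by rewrite (negbTE (_ : (i : nat) != a)) ?scale0r.
Qed.

Section Derivations.
Variables P Q : cyclicModule.
Local Notation Y := (cyc_prod P Q).
Implicit Types (x : gr P) (y : gr Q) (m u v : bitseq).

Definition sd (R : cyclicModule) k (z : gr R) : gr R := (-1) ^+ k *: gd k z.

Lemma sface_word c u u' (a b a' b' : bool) v v' x y : size u = size u' ->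
  sd (size u) (word c (u ++ [:: a, b & v]) (u' ++ [:: a', b' & v']) x y) =
  word (size u + c) (u ++ (a || b) :: v) (u' ++ (a' || b') :: v')
    (if a && b then gd (trues u) x else x)
    (if a' && b' then gd (trues u') y else y).
Proof. by move=> s12; rewrite /sd gd_word // sgn_word. Qed.

Lemma word_sdl c m1 m2 k x y :
  word c m1 m2 (sd k x) y = word (k + c) m1 m2 (gd k x) y.
Proof. by rewrite /sd wordZl sgn_word. Qed.
Lemma word_sdr c m1 m2 k x y :
  word c m1 m2 x (sd k y) = word (k + c) m1 m2 x (gd k y).
Proof. by rewrite /sd wordZr sgn_word. Qed.

(** A face of a word is a word with a face of x if it merges two letters of x,
    and with a face of y if it merges two letters of y.  If it merges a letter
    of x with one of y, then the two possible orders give opposite results. *)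
Lemma sface_sword11 u v x y :
  sd (size u) (sword (u ++ [:: true, true & v]) x y) =
  sword (u ++ true :: v) (sd (trues u) x) y.
Proof.
rewrite /sword !flip_cat sface_word ?size_flip // word_sdl; apply: word_parity.
by rewrite !inversions_cat size_trues; parity.
Qed.

Lemma sface_sword00 u v x y :
  sd (size u) (sword (u ++ [:: false, false & v]) x y) =
  - sword (u ++ false :: v) (gsgn x) (sd (falses u) y).
Proof.
rewrite /sword !flip_cat sface_word ?size_flip // word_sdr word_sgnl -wordS.
rewrite trues_flip /=; apply: word_parity.
by rewrite !inversions_cat !count_cat size_trues; parity.
Qed.

Lemma sface_sword10 u v x y :
  sd (size u) (sword (u ++ [:: true, false & v]) x y) = oword u v (gsgn x) y.
Proof.
rewrite /sword /oword !flip_cat sface_word ?size_flip // word_sgnl.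
apply: word_parity.
by rewrite !inversions_cat !count_cat size_trues; parity.
Qed.

Lemma sface_sword01 u v x y :
  sd (size u) (sword (u ++ [:: false, true & v]) x y) = - oword u v (gsgn x) y.
Proof.
rewrite /sword /oword !flip_cat sface_word ?size_flip // word_sgnl -wordS.
apply: word_parity.
by rewrite !inversions_cat !count_cat size_trues; parity.
Qed.

Lemma spread_b'_sd (R : cyclicModule) m (z : gr R) :
  spread m (gb' z) = spread m (\sum_(k < trues m) sd k z).
Proof.
by rewrite spread_b' linear_sum; apply: eq_bigr => k _; rewrite linearZ.
Qed.

Lemma sword_b'l m x y :
  sword m (gb' x) y = \sum_(k < trues m) sword m (sd k x) y.
Proof. by rewrite -sword_suml /sword /word spread_b'_sd. Qed.
Lemma sword_b'r m x y :
  sword m x (gb' y) = \sum_(k < falses m) sword m x (sd k y).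
Proof. by rewrite -sword_sumr /sword /word spread_b'_sd trues_flip. Qed.

Lemma sd_linear (R : cyclicModule) k : linear (@sd R k).
Proof.
by move=> a z z'; rewrite /sd [gd k _]linearP /= scalerDr !scalerA mulrC.
Qed.
HB.instance Definition _ (R : cyclicModule) k :=
  GRing.isLinear.Build rat (gr R) (gr R) _ (@sd R k) (@sd_linear R k).

Lemma gb'_gsh2 n x y :
  gb' (gsh2 n.+1 x y) = gsh2 n (gb' x) y - gsh2 n (gsgn x) (gb' y).
Proof.
rewrite gb'_masks; last by move=> m <-; apply: hom_sword.
have -> : gsh2 n (gb' x) y = splits n (fun u v =>
    sword (u ++ true :: v) (sd (trues u) x) y).
  rewrite -(slot_trues n (fun m k => sword m (sd k x) y)).
  by apply: eq_bigr => m _; rewrite sword_b'l.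
have -> : gsh2 n (gsgn x) (gb' y) = splits n (fun u v =>
    sword (u ++ false :: v) (gsgn x) (sd (falses u) y)).
  rewrite -(slot_falses n (fun m k => sword m (gsgn x) (sd k y))).
  by apply: eq_bigr => m _; rewrite sword_b'r.
rewrite -splitsN -splitsD; apply: eq_splits => u v _.
rewrite -[_ *: gd _ _]/(sd (size u) _) !linearD /=.
rewrite sface_sword11 sface_sword10 sface_sword01 sface_sword00.
by rewrite [- oword _ _ _ _ + _]addrC addrACA subrr addr0.
Qed.

Lemma before_11 i j u v : (i < before j (u ++ [:: true, true & v]))%N =
  ((if (i <= trues u)%N then i else i.-1) < before j (u ++ true :: v))%N.
Proof.
rewrite !before_cat /=; case: (ltnP j (falses u)) => ju; last first.
  by case: (leqP i (trues u)); lia.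
by case: (leqP i (trues u)) => // iu; have := before_le j u; lia.
Qed.

Lemma before_00 j u v : before j (u ++ [:: false, false & v]) =
  before (if (j <= falses u)%N then j else j.-1) (u ++ false :: v).
Proof.
rewrite !before_cat; case: (ltnP j (falses u)) => ju; first by rewrite (ltnW ju) ju.
case: (leqP j (falses u)) => ju'; first by rewrite ltnNge ju (_ : j - _ = 0)%N //=; lia.
have -> : (j.-1 < falses u)%N = false by lia.
have [k ->] : exists k, j = (falses u + k.+1)%N by exists (j - falses u).-1; lia.
by rewrite addnS /= -addnS !addKn.
Qed.

(** Exchanging two neighbouring letters, one of x and one of y, affects the
    condition of the cyclic shuffle only if they are a_0 and b_0. *)
Lemma before_10_01 i j u v :
  (i < before j (u ++ [:: true, false & v]))%N%:R -
  (i < before j (u ++ [:: false, true & v]))%N%:R =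
  ((i == trues u) && (j == falses u))%:R :> rat.
Proof.
rewrite !before_cat; case: (ltngtP j (falses u)) => [ju|ju|->] /=.
- by rewrite andbF subrr.
- have [k ->] : exists k, (j - falses u)%N = k.+1 by exists (j - falses u).-1; lia.
  by rewrite /= subrr andbF.
rewrite subnn /= addn0 addn1 ltnS leq_eqVlt andbT.
by case: eqP => [->|_]; rewrite ?ltnn ?subr0 //= subrr.
Qed.

Definition gcshm m x y : gr Y := \sum_(i < trues m) \sum_(j < falses m)
  (i < before j m)%N%:R *: sword m (gtaun i x) (gtaun j y).

Lemma gcshE n x y : gcsh n x y = \sum_(m <- masks n.+1) gcshm m x y.
Proof.
apply: eq_bigr => m _; apply: eq_bigr => i _; rewrite big_mkcond.
by apply: eq_bigr => j _ /=; case: ltnP; rewrite ?scale1r ?scale0r.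
Qed.

Lemma spread_weighted (R : cyclicModule) m (a : nat -> rat) (z : gr R) :
  spread m (\sum_(k < trues m) \sum_(i < (trues m).+1)
     a (if (i <= k)%N then i : nat else i.-1) *: sd k (gtaun i z)) =
  spread m (\sum_(i < trues m) a i *: gtaun i (gb z)).
Proof.
apply: spread_congr => n nm; rewrite -nm !gr_sumE.
rewrite -(weighted_gb'_gN a z n); apply: eq_bigr => k _; rewrite gr_sumE.
by apply: eq_bigr => i _; rewrite grZE /sd grZE gdE // leq_ord.
Qed.

Lemma swordZl m a x y : sword m (a *: x) y = a *: sword m x y.
Proof. exact: wordZl. Qed.
Lemma swordZr m a x y : sword m x (a *: y) = a *: sword m x y.
Proof. exact: wordZr. Qed.

Lemma sword_weightedl m (a : nat -> rat) x y :
  \sum_(k < trues m) \sum_(i < (trues m).+1)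
     a (if (i <= k)%N then i : nat else i.-1) *: sword m (sd k (gtaun i x)) y =
  \sum_(i < trues m) a i *: sword m (gtaun i (gb x)) y.
Proof.
transitivity (sword m (\sum_(i < trues m) a i *: gtaun i (gb x)) y).
  rewrite /sword /word -spread_weighted -/(word _ _ _ _ _) -/(sword _ _ _).
  rewrite sword_suml; apply: eq_bigr => k _.
  by rewrite sword_suml; apply: eq_bigr => i _; rewrite swordZl.
by rewrite sword_suml; apply: eq_bigr => i _; rewrite swordZl.
Qed.

Lemma sword_weightedr m (a : nat -> rat) x y :
  \sum_(k < falses m) \sum_(j < (falses m).+1)
     a (if (j <= k)%N then j : nat else j.-1) *: sword m x (sd k (gtaun j y)) =
  \sum_(j < falses m) a j *: sword m x (gtaun j (gb y)).
Proof.
transitivity (sword m x (\sum_(j < falses m) a j *: gtaun j (gb y))).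
  rewrite /sword /word -trues_flip -spread_weighted trues_flip.
  rewrite -/(word _ _ _ _ _) -/(sword _ _ _).
  rewrite sword_sumr; apply: eq_bigr => k _.
  by rewrite sword_sumr; apply: eq_bigr => i _; rewrite swordZr.
by rewrite sword_sumr; apply: eq_bigr => i _; rewrite swordZr.
Qed.

Lemma gsgn_gtaun (R : cyclicModule) i (z : gr R) :
  gsgn (gtaun i z) = gtaun i (gsgn z).
Proof. by elim: i => // k IH; rewrite !gtaunS gsgn_tau IH. Qed.

Lemma sd_gcshm11 u v x y : sd (size u) (gcshm (u ++ [:: true, true & v]) x y) =
  \sum_(j < falses (u ++ true :: v)) \sum_(i < (trues (u ++ true :: v)).+1)
    ((if (i <= trues u)%N then i : nat else i.-1) < before j (u ++ true :: v))%N%:R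
      *: sword (u ++ true :: v) (sd (trues u) (gtaun i x)) (gtaun j y).
Proof.
rewrite exchange_big /= /gcshm.
have -> : trues (u ++ [:: true, true & v]) = (trues (u ++ true :: v)).+1.
  by rewrite !count_cat /=; lia.
have -> : falses (u ++ [:: true, true & v]) = falses (u ++ true :: v).
  by rewrite !count_cat.
rewrite linear_sum; apply: eq_bigr => i _; rewrite linear_sum.
by apply: eq_bigr => j _; rewrite linearZ /= sface_sword11 before_11.
Qed.

Lemma sd_gcshm00 u v x y : sd (size u) (gcshm (u ++ [:: false, false & v]) x y) =
  - \sum_(i < trues (u ++ false :: v)) \sum_(j < (falses (u ++ false :: v)).+1)
    (i < before (if (j <= falses u)%N then j : nat else j.-1) (u ++ false :: v))%N%:R
      *: sword (u ++ false :: v) (gtaun i (gsgn x)) (sd (falses u) (gtaun j y)).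
Proof.
rewrite /gcshm.
have -> : falses (u ++ [:: false, false & v]) = (falses (u ++ false :: v)).+1.
  by rewrite !count_cat /=; lia.
have -> : trues (u ++ [:: false, false & v]) = trues (u ++ false :: v).
  by rewrite !count_cat.
rewrite linear_sum -sumrN; apply: eq_bigr => i _; rewrite linear_sum -sumrN.
apply: eq_bigr => j _; rewrite linearZ /= sface_sword00 before_00 gsgn_gtaun.
by rewrite scalerN.
Qed.

Lemma sd_gcshm_mixed u v x y :
  sd (size u) (gcshm (u ++ [:: true, false & v]) x y) +
  sd (size u) (gcshm (u ++ [:: false, true & v]) x y) =
  oword u v (gtaun (trues u) (gsgn x)) (gtaun (falses u) y).
Proof.
have t1 : (trues u < (trues (u ++ v)).+1)%N by rewrite count_cat ltnS leq_addr.
have f1 : (falses u < (falses (u ++ v)).+1)%N by rewrite count_cat ltnS leq_addr.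
rewrite /gcshm.
have -> : trues (u ++ [:: true, false & v]) = (trues (u ++ v)).+1.
  by rewrite !count_cat /=; lia.
have -> : trues (u ++ [:: false, true & v]) = (trues (u ++ v)).+1.
  by rewrite !count_cat /=; lia.
have -> : falses (u ++ [:: true, false & v]) = (falses (u ++ v)).+1.
  by rewrite !count_cat /=; lia.
have -> : falses (u ++ [:: false, true & v]) = (falses (u ++ v)).+1.
  by rewrite !count_cat /=; lia.
rewrite -[RHS](sum_delta (fun i j => oword u v (gtaun i (gsgn x)) (gtaun j y)) t1 f1).
rewrite !linear_sum -big_split; apply: eq_bigr => i _ /=.
rewrite !linear_sum -big_split; apply: eq_bigr => j _ /=.
rewrite [sd _ ((i < before j (u ++ [:: true, false & v]))%N%:R *: _)]linearZ /=.
rewrite [sd _ ((i < before j (u ++ [:: false, true & v]))%N%:R *: _)]linearZ /=.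
rewrite sface_sword10 sface_sword01 scalerN -scalerBl.
by rewrite before_10_01 gsgn_gtaun.
Qed.

(** The faces that merge two letters of x, or two letters of y, add up to
    C(b x, y) and C(x, b y).  The remaining ones cancel in pairs, except when
    a_0 meets b_0: these are the rotations of the words of SH. *)
Lemma gb'_gcsh n x y : gb' (gcsh n.+1 x y) =
  gcsh n (gb x) y - gcsh n (gsgn x) (gb y) + gN (gsh n (gsgn x) y).
Proof.
rewrite gcshE gb'_masks; last first.
  move=> m <-; apply: hom_sum => i _; apply: hom_sum => j _ k km.
  by rewrite grZE (hom_sword _ _ km) scaler0.
pose H1 m k := \sum_(j < falses m) \sum_(i < (trues m).+1)
    ((if (i <= k)%N then i : nat else i.-1) < before j m)%N%:R
      *: sword m (sd k (gtaun i x)) (gtaun j y).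
pose H0 m k := \sum_(i < trues m) \sum_(j < (falses m).+1)
    (i < before (if (j <= k)%N then j : nat else j.-1) m)%N%:R
      *: sword m (gtaun i (gsgn x)) (sd k (gtaun j y)).
have -> : gcsh n (gb x) y = splits n (fun u v => H1 (u ++ true :: v) (trues u)).
  rewrite -slot_trues gcshE; apply: eq_bigr => m _.
  rewrite /gcshm exchange_big [RHS]exchange_big /=; apply: eq_bigr => j _.
  exact/esym/(sword_weightedl m (fun i => (i < before j m)%N%:R)).
have -> : gcsh n (gsgn x) (gb y) =
    splits n (fun u v => H0 (u ++ false :: v) (falses u)).
  rewrite -slot_falses gcshE; apply: eq_bigr => m _.
  rewrite /gcshm [RHS]exchange_big /=; apply: eq_bigr => i _.
  exact/esym/(sword_weightedr m (fun j => (i < before j m)%N%:R)).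
rewrite gN_gsh -splitsN -!splitsD; apply: eq_splits => u v _.
rewrite -[_ *: gd _ _]/(sd (size u) _) !linearD /= -addrA [X in _ + X]addrA.
by rewrite sd_gcshm_mixed sd_gcshm11 sd_gcshm00 [X in _ + X]addrC addrA.
Qed.

End Derivations.

(** * Faces of the shuffle product *)

Section ShuffleDerivation.
Variables P Q : cyclicModule.
Local Notation Y := (cyc_prod P Q).
Implicit Types (x : gr P) (y : gr Q) (m u v : bitseq).

Local Notation owd := (oword [::]).

Lemma sd0 (R : cyclicModule) (z : gr R) : sd 0 z = gd 0 z.
Proof. by rewrite /sd expr0 scale1r. Qed.

Lemma owd_b'l m x y :
  owd m (gb' x) y = owd m (gd 0 x) y + \sum_(k < trues m) owd m (sd k.+1 x) y.
Proof.
by rewrite {1}/oword /word spread_b'_sd -/(word _ _ _ _ _) -/(oword _ _ _ _)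
  {1}/oword word_suml big_ord_recl sd0.
Qed.

Lemma owd_b'r m x y :
  owd m x (gb' y) = owd m x (gd 0 y) + \sum_(k < falses m) owd m x (sd k.+1 y).
Proof.
rewrite {1}/oword /word spread_b'_sd -/(word _ _ _ _ _) -/(oword _ _ _ _).
have -> : trues (flip [::] ++ true :: flip m) = (falses m).+1.
  by rewrite -trues_flip.
by rewrite {1}/oword word_sumr big_ord_recl sd0.
Qed.

Lemma sface_owd11 u v x y :
  sd (size u).+1 (owd (u ++ [:: true, true & v]) x y) =
  owd (u ++ true :: v) (sd (trues u).+1 x) y.
Proof.
rewrite /oword /= !flip_cat (@sface_word _ _ _ (true :: u) (true :: flip u)) /=;
  last by rewrite size_flip.
rewrite word_sdl; apply: word_parity.
by rewrite !inversions_cat size_trues; parity.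
Qed.

Lemma sface_owd00 u v x y :
  sd (size u).+1 (owd (u ++ [:: false, false & v]) x y) =
  owd (u ++ false :: v) (gsgn x) (sd (falses u).+1 y).
Proof.
rewrite /oword /= !flip_cat (@sface_word _ _ _ (true :: u) (true :: flip u)) /=;
  last by rewrite size_flip.
rewrite word_sdr word_sgnl trues_flip; apply: word_parity.
by rewrite !inversions_cat /= count_cat size_trues; parity.
Qed.

(** The two orders of the merged letters differ by a transposition. *)
Lemma sface_owd_mixed u v x y :
  sd (size u).+1 (owd (u ++ [:: true, false & v]) x y) +
  sd (size u).+1 (owd (u ++ [:: false, true & v]) x y) = 0.
Proof.
rewrite /oword /= !flip_cat !(@sface_word _ _ _ (true :: u) (true :: flip u)) /=;
  try by rewrite size_flip.
apply/eqP; rewrite addrC addr_eq0 -wordS; apply/eqP/word_parity.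
by rewrite !inversions_cat size_trues; parity.
Qed.

Lemma gd0_owd1 m x y : gd 0 (owd (true :: m) x y) = owd m (gd 0 x) y.
Proof. exact: (@gd_word _ _ _ [::] [::]). Qed.

Lemma owd_sgnl m x y : owd m (gsgn x) y =
  word (trues m + inversions m) (true :: m) (true :: flip m) x y.
Proof. by rewrite {1}/oword word_sgnl; apply: word_parity; parity. Qed.

Lemma gd0_owd0 m x y : gd 0 (owd (false :: m) x y) = owd m (gsgn x) (gd 0 y).
Proof. by rewrite owd_sgnl; apply: (@gd_word _ _ _ [::] [::]). Qed.

Lemma gd0_oword1 a m x y : gd 0 (oword [:: a] m x y) =
  owd m (if a then gd 0 x else gsgn x) (if a then y else gd 0 y).
Proof.
case: a; last by rewrite owd_sgnl; apply: (@gd_word _ _ _ [::] [::]).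
exact: (@gd_word _ _ _ [::] [::]).
Qed.

Lemma gb'_gsh n x y :
  gb' (gsh n.+1 x y) = gsh n (gb' x) y + gsh n (gsgn x) (gb' y).
Proof.
(* The shared slot is seen as the first, true, slot of a longer mask, so that *)
(* one formula for the faces of sums over masks covers all slots.             *)
pose F m := if m is true :: m' then owd m' x y else 0.
have -> : gsh n.+1 x y = \sum_(m <- masks n.+2) F m.
  by rewrite masksS [X in _ + X]big1 ?addr0.
rewrite gb'_masks; last first.
  by move=> [|[] m] //= [<-]; apply: (hom_oword (u := [::])).
have -> : gsh n (gb' x) y = \sum_(m <- masks n) owd m (gd 0 x) y +
    \sum_(m <- masks n) \sum_(k < trues m) owd m (sd k.+1 x) y.
  by rewrite -big_split; apply: eq_bigr => m _; rewrite owd_b'l.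
have -> : gsh n (gsgn x) (gb' y) = \sum_(m <- masks n) owd m (gsgn x) (gd 0 y) +
    \sum_(m <- masks n) \sum_(k < falses m) owd m (gsgn x) (sd k.+1 y).
  by rewrite -big_split; apply: eq_bigr => m _; rewrite owd_b'r.
rewrite addrACA -big_split /=.
case: n => [|n].
  rewrite splits0 masks0 !masks0 /= !big_ord0 !addr0 expr0 scale1r linearD /=.
  by rewrite gd0_owd1 gd0_owd0.
rewrite splits_cons; congr (_ + _).
  apply: eq_bigr => m _ /=; rewrite !addr0 expr0 scale1r linearD /=.
  by rewrite gd0_owd1 gd0_owd0.
rewrite (slot_trues n (fun m k => owd m (sd k.+1 x) y)).
rewrite (slot_falses n (fun m k => owd m (gsgn x) (sd k.+1 y))) -!splitsD.
apply: eq_splits => u v _ /=; rewrite !addr0 linear0 scaler0 addr0.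
have sdE k (z : gr Y) : (-1) ^+ k *: gd k z = sd k z by [].
rewrite sdE !linearD /= sface_owd11 sface_owd00 -addrA; congr (_ + _).
by rewrite addrA sface_owd_mixed add0r.
Qed.

(** The last face is d_0 tau.  The rotation puts the last letter in front of the
    slot of a_0 and b_0, and d_0 multiplies it into this slot. *)
Lemma gb_gsh n x y :
  gb (gsh n.+1 x y) = gsh n (gb x) y + gsh n (gsgn x) (gb y).
Proof.
have -> : gsh n (gb x) y = gsh n (gb' x) y + gsh n (gd 0 (gtau x)) y.
  rewrite -big_split; apply: eq_bigr => m _ /=.
  by rewrite gbb' {1}/oword wordDl.
have -> : gsh n (gsgn x) (gb y) =
    gsh n (gsgn x) (gb' y) + gsh n (gsgn x) (gd 0 (gtau y)).
  rewrite -big_split; apply: eq_bigr => m _ /=.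
  by rewrite gbb'; apply: linearDr.
rewrite gbb' gb'_gsh [RHS]addrACA; congr (_ + _).
rewrite [gsh n.+1 x y]masks_rcons linearD /= linearD /=.
by congr (_ + _); rewrite [gtau _]linear_sum [gd 0 _]linear_sum;
  apply: eq_bigr => m _; rewrite /= tau_oword gd0_oword1.
Qed.

End ShuffleDerivation.

(** * Strict commutation with B *)

Ltac zatom e :=
  match e with
  | (?a + _)%R => zatom a
  | (_ + ?a)%R => zatom a
  | (_ + _)%R => fail 1
  | (- ?a)%R => zatom a
  | (- _)%R => fail 1
  | 0%R => fail 1
  | _ => let _ := match goal with _ => assert_fails (is_var e) end in e
  end.

(** Identities of abelian groups: the atoms are generalized, and then the terms
    of the difference of both sides are cancelled one after the other. *)
Ltac zmod :=
  repeat match goal with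
  | |- ?l = _ => let e := zatom l in let v := fresh in set v := e; clearbody v
  | |- _ = ?r => let e := zatom r in let v := fresh in set v := e; clearbody v
  end;
  apply/eqP; rewrite -subr_eq0; apply/eqP; rewrite -[LHS]add0r;
  rewrite ?(opprD, opprK, oppr0, addrA, addr0);
  repeat match goal with
  | |- _ - ?u = 0 => rewrite ?(addrAC _ u) addrNK
  | |- _ + ?u = 0 => rewrite ?(addrAC _ (- u)) addrK
  end; try by [].

Section GradedCommutators.
Variables (X1 X2 Z : lmodType rat).
Variables (s1 b1 B1 : {linear X1 -> X1}) (b2 B2 : {linear X2 -> X2}).
Variables (b B : {linear Z -> Z}).
Hypotheses (s1K : forall x, s1 (s1 x) = x)
  (s1b : forall x, s1 (b1 x) = - b1 (s1 x))
  (s1B : forall x, s1 (B1 x) = - B1 (s1 x))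
  (bB1 : forall x, b1 (B1 x) = - B1 (b1 x))
  (bB2 : forall y, b2 (B2 y) = - B2 (b2 y))
  (bB : forall z, b (B z) = - B (b z))
  (BB1 : forall x, B1 (B1 x) = 0) (BB2 : forall y, B2 (B2 y) = 0)
  (BB : forall z, B (B z) = 0).

(** The graded commutators of d, an operator of odd degree, with bilinear maps
    of even or odd degree. *)
Definition comm_even (d1 : X1 -> X1) (d2 : X2 -> X2) (d : Z -> Z)
    (F : X1 -> X2 -> Z) x y : Z := d (F x y) - F (d1 x) y - F (s1 x) (d2 y).
Definition comm_odd (d1 : X1 -> X1) (d2 : X2 -> X2) (d : Z -> Z)
    (F : X1 -> X2 -> Z) x y : Z := d (F x y) + F (d1 x) y + F (s1 x) (d2 y).

Lemma comm_odd_bilinear (d1 : {linear X1 -> X1}) (d2 : {linear X2 -> X2})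
    (d : {linear Z -> Z}) (F : {bilinear X1 -> X2 -> Z}) :
  bilinear_for *:%R *:%R (comm_odd d1 d2 d F).
Proof.
split=> [y a x x'|x a y y'] /=; rewrite /comm_odd.
  by rewrite !linearPl !linearP !linearPl !scalerDr; zmod.
rewrite [d2 _]linearP /= !linearPr linearP !scalerDr; zmod.
Qed.

Lemma comm_even_bilinear (d1 : {linear X1 -> X1}) (d2 : {linear X2 -> X2})
    (d : {linear Z -> Z}) (F : {bilinear X1 -> X2 -> Z}) :
  bilinear_for *:%R *:%R (comm_even d1 d2 d F).
Proof.
split=> [y a x x'|x a y y'] /=; rewrite /comm_even.
  by rewrite !linearPl !linearP !linearPl !scalerDr !scalerN; zmod.
rewrite [d2 _]linearP /= !linearPr linearP !scalerDr !scalerN; zmod.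
Qed.

HB.instance Definition _ (d1 : {linear X1 -> X1}) (d2 : {linear X2 -> X2})
    (d : {linear Z -> Z}) (F : {bilinear X1 -> X2 -> Z}) :=
  bilinear_isBilinear.Build rat X1 X2 Z *:%R *:%R (comm_even d1 d2 d F)
    (comm_even_bilinear d1 d2 d F).

Lemma comm_even_add d1 d2 (d : {linear Z -> Z}) F F' x y :
  comm_even d1 d2 d (fun x y => F x y + F' x y) x y =
  comm_even d1 d2 d F x y + comm_even d1 d2 d F' x y.
Proof. by rewrite /comm_even linearD /=; zmod. Qed.

Lemma comm_even_odd_B (F : {bilinear X1 -> X2 -> Z}) x y :
  comm_even B1 B2 B (comm_odd B1 B2 B F) x y = 0.
Proof.
rewrite /comm_even /comm_odd !linearD /= BB BB1 BB2 s1B s1K.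
rewrite linear0l linear0r linearNl.
by zmod.
Qed.

(** The graded Jacobi identity, where [b,B] = 0. *)
Lemma comm_even_b_odd_B (F : {bilinear X1 -> X2 -> Z}) x y :
  comm_even b1 b2 b (comm_odd B1 B2 B F) x y =
  - comm_even B1 B2 B (comm_odd b1 b2 b F) x y.
Proof.
rewrite /comm_even /comm_odd !linearD /= bB bB1 bB2 !s1B !s1b !s1K.
rewrite !linearNl !linearNr.
by zmod.
Qed.
End GradedCommutators.

Section Strictification.
Variables P Q Y : cyclicModule.
Implicit Types (x : gr P) (y : gr Q).
Variables SH SH2 C : {bilinear gr P -> gr Q -> gr Y}.
Hypothesis b_SH : forall x y,
  gb (SH x y) = SH (gb x) y + SH (gsgn x) (gb y).
Hypothesis b'_SH2 : forall x y,
  gb' (SH2 x y) = SH2 (gb' x) y - SH2 (gsgn x) (gb' y).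
Hypothesis T_C : forall x y,
  gT (C x y) = SH (gR (gN x)) y + SH (gsgn x) (gR (gN y)).
Hypothesis b'_C : forall x y,
  gb' (C x y) = gN (SH x y) - C (gb x) y - C (gsgn x) (gb y).
Hypothesis C_Tl : forall x y,
  C (gT x) y = gN (SH (gR x) y) + SH2 (gsgn x) (gN y).
Hypothesis C_Tr : forall x y,
  C x (gT y) = gN (SH (gsgn x) (gR y)) - SH2 (gN (gsgn x)) y.
Hypothesis R_SH2 : forall x y, gR (SH2 x y) = SH (gR x) (gR y).

(** The first two terms form the tensor product of the homotopy lambda between
    rho and 1 with itself, which connects SH with SH(rho,rho); the last one
    accounts for the rest of gG by the formula for b R R. *)
Definition gK x y : gr Y :=
  SH (glambda x) y + SH (grho (gsgn x)) (glambda y)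
  - gR (gR (SH2 (gkappa x) (gkappa y))).

Definition gG x y : gr Y := SH (grho x) (grho y)
  + (gT (gR (SH2 (gkappa x) (gkappa y))) - gR (SH2 (gkappa x) (gkappa y))).

Definition gM x y : gr Y := gT (gR (C (gpi x) (gpi y))).

Lemma gK_bilinear : bilinear_for *:%R *:%R gK.
Proof.
split=> [y a x x'|x a y y'] /=; rewrite /gK.
  rewrite [glambda _]linearP [gsgn _]linearP [grho _]linearP [gkappa (_ + _)]linearP /=.
  rewrite !linearPl [gR (_ + _)]linearP [gR (_ + _)]linearP /=.
  rewrite !scalerDr scalerN; zmod.
rewrite [glambda (_ + _)]linearP /= [gkappa (_ + _)]linearP /=.
rewrite !linearPr [gR (_ + _)]linearP [gR (_ + _)]linearP /=.
rewrite !scalerDr scalerN; zmod.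
Qed.
HB.instance Definition _ := bilinear_isBilinear.Build rat
  (gr P) (gr Q) (gr Y) *:%R *:%R gK gK_bilinear.

Lemma gM_bilinear : bilinear_for *:%R *:%R gM.
Proof.
split=> [y a x x'|x a y y'] /=; rewrite /gM [gpi (_ + _)]linearP /=.
  by rewrite linearPl [gR _]linearP [gT _]linearP.
by rewrite linearPr [gR _]linearP [gT _]linearP.
Qed.
HB.instance Definition _ := bilinear_isBilinear.Build rat
  (gr P) (gr Q) (gr Y) *:%R *:%R gM gM_bilinear.

Lemma gb_lambda (R : cyclicModule) (z : gr R) :
  gb (glambda z) = z - grho z - glambda (gb z).
Proof. by rewrite grhoE; zmod. Qed.

Lemma gb'_kappa (R : cyclicModule) (z : gr R) :
  gb' (gkappa z) = - gkappa (gb z).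
Proof. by rewrite gkappa_b opprK. Qed.

Lemma gb_sgn (R : cyclicModule) (z : gr R) : gb (gsgn z) = - gsgn (gb z).
Proof. by rewrite gsgn_b opprK. Qed.

Lemma gND (R : cyclicModule) (z z' : gr R) : gN (z + z') = gN z + gN z'.
Proof. exact: linearD. Qed.
Lemma gNN (R : cyclicModule) (z : gr R) : gN (- z) = - gN z.
Proof. exact: linearN. Qed.
Lemma gTR_D (R : cyclicModule) (z z' : gr R) :
  gT (gR (z + z')) = gT (gR z) + gT (gR z').
Proof. by rewrite [gR _]linearD [gT _]linearD. Qed.
Lemma gTR_0 (R : cyclicModule) : gT (gR (0 : gr R)) = 0.
Proof. by rewrite [gR _]linear0 linear0. Qed.
Lemma gTR_N (R : cyclicModule) (z : gr R) : gT (gR (- z)) = - gT (gR z).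
Proof. by rewrite [gR _]linearN [gT _]linearN. Qed.

Lemma comm_odd_b_K x y :
  comm_odd (@gsgn P) (@gb P) (@gb Q) (@gb Y) gK x y = SH x y - gG x y.
Proof.
rewrite /comm_odd /gK /gG.
rewrite [gb (_ - _)]linearB /= [gb (_ + _)]linearD /= !b_SH gb_rr b'_SH2.
rewrite !gb'_kappa gsgn_lambda gsgn_kappa gb_rho gsgn_rho gsgnK gb_sgn !gb_lambda.
rewrite [grho (- _)]linearN !linearNl !linearNr !linearBl !linearBr opprK /=.
rewrite [gR (_ - _)]linearB /= [gR (- _)]linearN /=.
rewrite [gR (_ - _)]linearB /= [gR (- _)]linearN /=.
by zmod.
Qed.

(** From b T R C = T C - T R b' C come the terms SH(R N,1) and SH(s,R N), where
    R N = rho B, and B SH.  The defect - T kappa of the commutation of pi with b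
    enters C(T kappa,pi) and C(pi,T kappa), and the values of these terms
    complete SH(pi,pi) to SH(rho,rho), up to SH2(kappa,kappa). *)
Lemma comm_even_b_M x y :
  comm_even (@gsgn P) (@gb P) (@gb Q) (@gb Y) gM x y =
  - comm_even (@gsgn P) (@gB P) (@gB Q) (@gB Y) gG x y.
Proof.
rewrite /comm_even /gM /gG.
rewrite gb_T gb'_r [gT (_ - _)]linearB /= T_C b'_C !gb_pi !gsgn_pi !gN_pi.
rewrite linearBl /= linearBr /= C_Tl C_Tr !gsgn_pi !gsgnK !gN_pi.
rewrite !grho_B !gkappa_B !grhoD !linearDl !linearDr /= -!R_SH2.
rewrite gBE gsgn_kappa linearNl /= !(gND, gNN, gN_T, gTR_D, gTR_N, gTR_0).
by zmod.
Qed.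

Definition SHc x y : gr Y :=
  gM x y + comm_odd (@gsgn P) (@gB P) (@gB Q) (@gB Y) gK x y.

Lemma SHc_bilinear : bilinear_for *:%R *:%R SHc.
Proof.
have [Kl Kr] := comm_odd_bilinear (@gsgn P) (@gB P) (@gB Q) (@gB Y) gK.
split=> [y a x x'|x a y y'] /=; rewrite /SHc.
  have /= -> := Kl y a x x'.
  by rewrite linearPl /= [in RHS]scalerDr addrACA.
have /= -> := Kr x a y y'.
by rewrite linearPr /= [in RHS]scalerDr addrACA.
Qed.
HB.instance Definition _ := bilinear_isBilinear.Build rat
  (gr P) (gr Q) (gr Y) *:%R *:%R SHc SHc_bilinear.

Lemma comm_even_b_SHc x y :
  comm_even (@gsgn P) (@gb P) (@gb Q) (@gb Y) SHc x y =
  - comm_even (@gsgn P) (@gB P) (@gB Q) (@gB Y) SH x y.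
Proof.
rewrite comm_even_add comm_even_b_M.
rewrite (comm_even_b_odd_B (@gsgnK P) (@gsgn_b P) (@gsgn_B P) (@gb_B P)
  (@gb_B Q) (@gb_B Y)).
rewrite -opprD -comm_even_add; congr (- _).
rewrite /comm_even !comm_odd_b_K.
have e u v : u + (v - u) = v :> gr Y by rewrite addrC subrK.
by rewrite /= !e.
Qed.

(** B M vanishes by N T = 0, and M(B,1), M(s,B) vanish by pi B = 0; the
    other summand of SHc is [B,K], and [B,[B,K]] = 0. *)
Lemma comm_even_B_SHc x y :
  comm_even (@gsgn P) (@gB P) (@gB Q) (@gB Y) SHc x y = 0.
Proof.
rewrite comm_even_add (comm_even_odd_B (@gsgnK P) (@gsgn_B P) (@gB_B P)
  (@gB_B Q) (@gB_B Y)) addr0.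
rewrite /comm_even /gM /= gBE gN_T !gpi_B linear0l linear0r.
by rewrite [gR _]linear0 linear0 !subr0.
Qed.
End Strictification.

(** * The three shuffle operations on families *)

Section Global.
Variables P Q : cyclicModule.
Local Notation Y := (cyc_prod P Q).
Implicit Types (x : gr P) (y : gr Q).

Definition gSH x y : gr Y := fun n => gsh n x y n.
Definition gSH2 x y : gr Y := fun n => gsh2 n x y n.
(** The sign s makes gC an operation of degree 1 for the usual sign rule. *)
Definition gC x y : gr Y := fun n => gcsh n (gsgn x) y n.

Lemma gSH_bilinear : bilinear_for *:%R *:%R gSH.
Proof.
split=> [y a x x'|x a y y'] /=; apply: gr_ext => n; rewrite grDE grZE /gSH -grZE -grDE;
  congr (_ n); rewrite scaler_sumr -big_split; apply: eq_bigr => m _.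
  exact: wordPl.
exact: wordPr.
Qed.
HB.instance Definition _ := bilinear_isBilinear.Build rat
  (gr P) (gr Q) (gr Y) *:%R *:%R gSH gSH_bilinear.

Lemma gSH2_bilinear : bilinear_for *:%R *:%R gSH2.
Proof.
split=> [y a x x'|x a y y'] /=; apply: gr_ext => n; rewrite grDE grZE /gSH2 -grZE -grDE;
  congr (_ n); rewrite scaler_sumr -big_split; apply: eq_bigr => m _.
  exact: wordPl.
exact: wordPr.
Qed.
HB.instance Definition _ := bilinear_isBilinear.Build rat
  (gr P) (gr Q) (gr Y) *:%R *:%R gSH2 gSH2_bilinear.

Lemma gC_bilinear : bilinear_for *:%R *:%R gC.
Proof.
split=> [y a x x'|x a y y'] /=; apply: gr_ext => n; rewrite grDE grZE /gC -grZE -grDE;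
  congr (_ n); rewrite scaler_sumr -big_split; apply: eq_bigr => m _ /=;
  rewrite scaler_sumr -big_split; apply: eq_bigr => i _ /=;
  rewrite scaler_sumr -big_split; apply: eq_bigr => j _ /=.
  rewrite !linearP; exact: wordPl.
rewrite linearP; exact: wordPr.
Qed.
HB.instance Definition _ := bilinear_isBilinear.Build rat
  (gr P) (gr Q) (gr Y) *:%R *:%R gC gC_bilinear.

Lemma gb_SH x y : gb (gSH x y) = gSH (gb x) y + gSH (gsgn x) (gb y).
Proof. by apply: gr_ext => n; rewrite -[LHS]/(gb (gsh n.+1 x y) n) gb_gsh. Qed.

Lemma gb'_SH2 x y : gb' (gSH2 x y) = gSH2 (gb' x) y - gSH2 (gsgn x) (gb' y).
Proof. by apply: gr_ext => n; rewrite -[LHS]/(gb' (gsh2 n.+1 x y) n) gb'_gsh2. Qed.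

Lemma gT_congr (R : cyclicModule) (z z' : gr R) n : z n = z' n -> gT z n = gT z' n.
Proof. by move=> e; rewrite !gTE !grE !gtauE e. Qed.
Lemma gN_congr (R : cyclicModule) (z z' : gr R) n : z n = z' n -> gN z n = gN z' n.
Proof. by move=> e; rewrite !gNE; apply: eq_bigr => i _; apply: gtaun_congr. Qed.

Lemma gT_C x y : gT (gC x y) = gSH (gR (gN x)) y + gSH (gsgn x) (gR (gN y)).
Proof.
apply: gr_ext => n; rewrite (gT_congr (z' := gcsh n (gsgn x) y)) //.
by rewrite gT_gcsh gsgnK addrC.
Qed.

Lemma gb'_C x y :
  gb' (gC x y) = gN (gSH x y) - gC (gb x) y - gC (gsgn x) (gb y).
Proof.
apply: gr_ext => n; rewrite !grE.
have -> : gN (gSH x y) n = gN (gsh n x y) n by apply: gN_congr.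
have -> : gC (gsgn x) (gb y) n = gcsh n x (gb y) n by rewrite /gC gsgnK.
have eA : gcsh n (gb (gsgn x)) y n = - gC (gb x) y n.
  have -> : gb (gsgn x) = gsgn (- gb x) by rewrite linearN /= gsgn_b opprK.
  by rewrite -[LHS]/(gC (- gb x) y n) linearNl.
rewrite -[LHS]/(gb' (gcsh n.+1 (gsgn x) y) n) gb'_gcsh !grE gsgnK eA.
by rewrite addrC addrA.
Qed.

Lemma gC_Tl x y : gC (gT x) y = gN (gSH (gR x) y) + gSH2 (gsgn x) (gN y).
Proof.
apply: gr_ext => n; rewrite grDE (gN_congr (z' := gsh n (gR x) y)) //.
by rewrite gN_gsh_Rl /gC gsgn_T gcsh_Tl addrC.
Qed.

Lemma gC_Tr x y : gC x (gT y) = gN (gSH (gsgn x) (gR y)) - gSH2 (gN (gsgn x)) y.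
Proof.
apply: gr_ext => n; rewrite grDE (gN_congr (z' := gsh n (gsgn x) (gR y))) //.
by rewrite gN_gsh_Rr /gC gcsh_Tr.
Qed.

Lemma gR_SH2 x y : gR (gSH2 x y) = gSH (gR x) (gR y).
Proof.
apply: gr_ext => -[|n].
  rewrite /gSH [gsh 0 _ _]masks0 oword_Rl /word spread_true_r grZE /gpure.
  by rewrite /spread /with_slots /= pure0 scaler0.
rewrite -[LHS]/(gR (gsh2 n x y) n.+1) /gSH; congr (_ n.+1).
rewrite linear_sum; apply: eq_bigr => m _ /=.
by rewrite R_word oword_Rl /word spread_true_r.
Qed.

End Global.

(** * Shuffle permutations as masks *)

(** With k = 0, the values mu (for a = true) or nu (for a = false) of the
    partition that is coded by m. *)
Fixpoint positions (a : bool) (k : nat) (m : bitseq) : seq nat :=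
  if m is c :: m' then
    (if c == a then k :: positions a k.+1 m' else positions a k.+1 m')
  else [::].

Lemma positions_rcons a c k m : positions a k (rcons m c) =
  if c == a then rcons (positions a k m) (k + size m)%N else positions a k m.
Proof.
elim: m k => [|c' m IH] k /=; first by rewrite addn0; case: eqP.
by rewrite IH addSnnS; case: (c == a); case: (c' == a).
Qed.

Lemma size_perm_word n (s : 'S_n) : size (perm_word s) = n.
Proof. by rewrite size_map size_enum_ord. Qed.

Lemma nth_perm_word n (s : 'S_n) (i : 'I_n) : nth 0%N (perm_word s) i = s i.
Proof. by rewrite (nth_map i) ?size_enum_ord // nth_ord_enum. Qed.

Lemma perm_word_lt n (s : 'S_n) : all (fun j => (j < n)%N) (perm_word s).
Proof. by apply/allP => j /mapP[i _ ->]; apply: ltn_ord. Qed.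

Lemma perm_word_lift n (i : 'I_n.+1) (s : 'S_n) :
  perm_word (lift_perm i ord_max s) =
  take i (perm_word s) ++ n :: drop i (perm_word s).
Proof.
have i_n : (i <= n)%N by rewrite -ltnS.
apply: (@eq_from_nth _ 0%N) => [|j].
  by rewrite size_cat /= size_take_min size_drop !size_perm_word; lia.
rewrite size_perm_word => jn; rewrite -[j]/(val (Ordinal jn)).
rewrite nth_perm_word nth_cat size_take_min size_perm_word (minn_idPl i_n).
case: (unliftP i (Ordinal jn)) => [k ->|->]; last first.
  by rewrite lift_perm_id ltnn subnn.
rewrite lift_perm_lift lift_max /= /bump; case: (leqP i k) => ik.
  rewrite add1n ltnNge (leqW ik) /= subSn //= nth_drop subnKC //.
  by rewrite nth_perm_word.
by rewrite add0n ik nth_take // nth_perm_word.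
Qed.

Lemma sum_perm_lift n (V : lmodType rat) (F : 'S_n.+1 -> V) :
  \sum_(s : 'S_n.+1) F s =
  \sum_(i < n.+1) \sum_(s : 'S_n) F (lift_perm i ord_max s).
Proof.
pose f (u : 'I_n.+1 * 'S_n) := lift_perm u.1 ord_max u.2.
have f_inj : injective f.
  move=> [i s] [j t] e; rewrite /f /= in e.
  have ij : i = j.
    apply: (@perm_inj _ (lift_perm i ord_max s)).
    by rewrite {2}e !lift_perm_id.
  rewrite -{}ij in e *; congr (_, _); apply/permP => k.
  by apply: (@lift_inj _ ord_max); rewrite -!(lift_perm_lift i) e.
have f_bij : bijective f.
  by apply: inj_card_bij => //; rewrite card_prod !card_Sn card_ord factS.
rewrite (reindex f); last exact: onW_bij.
by rewrite pair_big.
Qed.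

Lemma sorted_insert_max n (u v : seq nat) : all (fun j => (j < n)%N) v ->
  sorted ltn (u ++ n :: v) -> v = [::].
Proof.
case: v => // j v /= /andP[jn _].
by rewrite (sorted_pairwise ltn_trans) pairwise_cat /= ltnNge (ltnW jn) !andbF.
Qed.

Lemma sorted_rcons_max n (u : seq nat) : all (fun j => (j < n)%N) u ->
  sorted ltn (rcons u n) = sorted ltn u.
Proof.
case: u => // j u /allP un; rewrite /= rcons_path.
by case: path => //=; apply: (un _ (mem_last j u)).
Qed.

(** In a shuffle the largest value is the last one of its block.  It sits at
    position i of the word, hence i.+1 = p or i = n. *)
Lemma is_shuffle_lift p n (i : 'I_n.+1) (s : 'S_n) : (p <= n.+1)%N ->
  is_shuffle p (lift_perm i ord_max s) =
  if (i < p)%N then (i.+1 == p) && is_shuffle p.-1 s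
  else (i == n :> nat) && is_shuffle p s.
Proof.
set w := perm_word s => pn; have sw : size w = n by apply: size_perm_word.
have lt_w : all (fun j => (j < n)%N) w by apply: perm_word_lt.
have lt_take k : all (fun j => (j < n)%N) (take k w).
  by apply/allP => j /mem_take; apply: (allP lt_w).
have lt_drop k : all (fun j => (j < n)%N) (drop k w).
  by apply/allP => j /mem_drop; apply: (allP lt_w).
have i_n : (i <= n)%N by rewrite -ltnS.
have tn : take n w = w by rewrite take_oversize ?sw.
have dn : drop n w = [::] by rewrite drop_oversize ?sw.
have si : size (take i w) = i by rewrite size_takel ?sw.
rewrite /is_shuffle perm_word_lift -/w take_cat drop_cat si.
case: (ltnP i p) => ip; last first.
  move: ip; rewrite leq_eqVlt => /orP[/eqP ip|ip]; last first.
    rewrite ip take_takel ?(ltnW ip) //.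
    case: (eqVneq (i : nat) n) => [->|ni].
      by rewrite tn dn cats1 sorted_rcons_max.
    apply/negbTE/negP => /andP[_ /sorted_insert_max]; move/(_ (lt_drop i)).
    by move/(congr1 size); rewrite size_drop sw /=; lia.
  rewrite -ip ltnn subnn take0 drop0 cats0.
  case: (eqVneq p n) => [->|ni].
    by rewrite dn /= andbT.
  apply/negbTE/negP => /andP[_ /(@sorted_insert_max _ [::])].
  move/(_ (lt_drop p)).
  by move/(congr1 size); rewrite size_drop sw /=; lia.
rewrite ltnNge (ltnW ip) /=.
have -> : (p - i = (p - i.+1).+1)%N by lia.
rewrite /= drop_drop; have -> : (p - i.+1 + i = p.-1)%N by lia.
case: (eqVneq i.+1 p) => [<-|ni].
  by rewrite subnn take0 cats1 sorted_rcons_max.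
apply/negbTE/negP => /andP[/sorted_insert_max].
have lt2 : all (fun j => (j < n)%N) (take (p - i.+1) (drop i w)).
  by apply/allP => j /mem_take; apply: (allP (lt_drop i)).
by move=> /(_ lt2) /(congr1 size); rewrite size_take_min size_drop sw /=; lia.
Qed.

Lemma sign_lift_perm n (i : 'I_n.+1) (s : 'S_n) :
  (-1) ^+ lift_perm i ord_max s = (-1) ^+ (i + n + s)%N :> rat.
Proof. by rewrite odd_lift_perm -[RHS]signr_odd !oddD oddb. Qed.

(** By induction on n: the largest value belongs to the first block if the mask
    ends with true and to the second block otherwise. *)
Lemma sum_shuffles (V : lmodType rat) n p (F : seq nat -> seq nat -> V) :
  (p <= n)%N ->
  \sum_(s : 'S_n | is_shuffle p s)
    (-1) ^+ s *: F (take p (perm_word s)) (drop p (perm_word s)) =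
  \sum_(m <- masks n | trues m == p)
    (-1) ^+ inversions m *: F (positions true 0 m) (positions false 0 m).
Proof.
elim: n p F => [|n IH] p F pn.
  rewrite leqn0 in pn; rewrite (eqP pn) (big_pred1 (1%g : 'S_0)) => [|s].
    have -> : perm_word (1%g : 'S_0) = [::].
      by apply: size0nil; rewrite size_perm_word.
    by rewrite big_mkcond masks0 odd_perm1.
  have -> : s = 1%g by apply/permP => -[].
  have w0 : perm_word (1%g : 'S_0) = [::].
    by apply: size0nil; rewrite size_perm_word.
  by rewrite /is_shuffle w0 /= eqxx.
pose A (i : nat) : V := if i.+1 == p then
  \sum_(s : 'S_n | is_shuffle p.-1 s) (-1) ^+ (i + n + s)%N *:
    F (rcons (take p.-1 (perm_word s)) n) (drop p.-1 (perm_word s)) else 0.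
pose B (i : nat) : V := if (i == n) && (p <= n)%N then
  \sum_(s : 'S_n | is_shuffle p s) (-1) ^+ s *:
    F (take p (perm_word s)) (rcons (drop p (perm_word s)) n) else 0.
rewrite big_mkcond sum_perm_lift.
transitivity (\sum_(i < n.+1) (A i + B i)).
  apply: eq_bigr => i _; rewrite -big_mkcond /=.
  under eq_bigl do rewrite is_shuffle_lift //.
  under eq_bigr => s _ do rewrite sign_lift_perm.
  have i_n : (i <= n)%N by rewrite -ltnS.
  rewrite /A /B; case: (ltnP i p) => ip.
    have -> : (i == n :> nat) && (p <= n)%N = false by apply/negbTE; lia.
    rewrite addr0; case: (eqVneq i.+1 p) => [<-|] /=; last by rewrite big_pred0_eq.
    apply: eq_bigr => s _; rewrite perm_word_lift -cat_rcons.
    by rewrite take_size_cat ?drop_size_cat ?size_rcons ?size_takel ?size_perm_word.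
  have -> : (i.+1 == p) = false by apply/negbTE; lia.
  rewrite add0r; case: (eqVneq (i : nat) n) => [i_eq|] /=; last by rewrite big_pred0_eq.
  have -> : (p <= n)%N by lia.
  apply: eq_bigr => s _; rewrite perm_word_lift i_eq.
  have -> : drop n (perm_word s) = [::] by rewrite drop_oversize ?size_perm_word.
  have -> : take n (perm_word s) = perm_word s.
    by rewrite take_oversize ?size_perm_word.
  rewrite cats1.
  rewrite drop_rcons ?size_perm_word; last by lia.
  rewrite -cats1 takel_cat ?size_perm_word; last by lia.
  by rewrite -signr_odd !oddD addbb addFb oddb.
rewrite big_split [RHS]big_mkcond masks_rcons /=; congr (_ + _).
  rewrite -[RHS]big_mkcond /=.
  under [RHS]eq_bigl do rewrite -cats1 count_cat /= addn1.
  case: p pn @A {B} => [|p] pn A; first by rewrite big1 // big_pred0_eq.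
  rewrite (bigD1 (Ordinal pn)) //= [X in _ + X]big1 ?addr0 => [|i ni]; last first.
    by rewrite /A (negbTE (_ : i.+1 != p.+1)).
  transitivity ((-1) ^+ (p + n)%N *: \sum_(s : 'S_n | is_shuffle p s)
      (-1) ^+ s *: F (rcons (take p (perm_word s)) n) (drop p (perm_word s))).
    rewrite /A eqxx scaler_sumr; apply: eq_bigr => s _.
    by rewrite scalerA exprD.
  rewrite (IH p (fun u v => F (rcons u n) v)) //.
  rewrite scaler_sumr big_seq_cond [RHS]big_seq_cond.
  apply: eq_big => m; rewrite ?eqSS // => /andP[/size_masks sm /eqP tm].
  rewrite !positions_rcons /= add0n sm inversions_rcons scalerA -exprD; congr (_ *: _).
  rewrite -signr_odd -[RHS]signr_odd -sm size_trues tm; congr (_ ^+ nat_of_bool _).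
  by rewrite muln1; parity.
rewrite -[RHS]big_mkcond /=.
under [RHS]eq_bigl do rewrite -cats1 count_cat /= addn0.
case: (leqP p n) pn @B {A} => [pn _ B|pn _ B]; last first.
  rewrite big1 => [|i _]; last by rewrite /B andbF.
  rewrite big_seq_cond big1 // => m /andP[/size_masks sm /eqP tm].
  by have := size_trues m; lia.
rewrite (bigD1 ord_max) //= [X in _ + X]big1 ?addr0 => [|i ni]; last first.
  by rewrite /B (negbTE (_ : (i : nat) != n)).
rewrite /B eqxx /= (IH p (fun u v => F u (rcons v n))) //.
rewrite big_seq_cond [RHS]big_seq_cond.
apply: eq_big => m; first by rewrite addn0.
move=> /andP[/size_masks sm _].
by rewrite !positions_rcons /= add0n sm inversions_rcons muln0 addn0.
Qed.

(** * Elements of one degree and the shuffle map *)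

Section SingleDegree.
Variable P : cyclicModule.

(** Unlike gs this does not ask that i be in range, as the indices are read off
    arbitrary sequences. *)
Definition gdegen i (z : gr P) : gr P :=
  fun n => if n is n'.+1 then degen P n' i (z n') else 0.

Lemma single_degen n i (x : P n) : single (degen P n i x) = gdegen i (single x).
Proof.
apply/esym/single_eqP => [|k nk]; first by rewrite /gdegen singleE.
by case: k nk => // k nk; rewrite /gdegen single_neq ?linear0.
Qed.

Lemma gs_single n i (x : P n) : (i <= n)%N -> gs i (single x) = gdegen i (single x).
Proof.
move=> le_in; apply: gr_ext => -[|k] //=; case: (eqVneq n k) => [<-|nk].
  by rewrite le_in.
by rewrite single_neq // linear0; case: ifP; rewrite ?linear0.
Qed.

Lemma single_degens w p q (x : P p) :
  single (degens P w p q x) = foldl (fun z i => gdegen i z) (single x) (map w (iota 0 q)).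
Proof.
elim: q => // q IH; rewrite -[in RHS]addn1 iotaD map_cat foldl_cat -IH /=.
exact: single_degen.
Qed.

Lemma place_single k m d (x : P d) : (k + trues m)%N = d ->
  place k.+1 m (single x) =
  foldl (fun z i => gdegen i z) (single x) (positions false k m).
Proof.
elim: m k d x => // -[] m IH k d x /= kd; first by apply: IH; lia.
rewrite gs_single; last by lia.
by rewrite -single_degen; apply: IH; lia.
Qed.

Lemma spread_single m d (x : P d) :
  spread (true :: m) (single x) = if trues m == d then
    foldl (fun z i => gdegen i z) (single x) (positions false 0 m) else 0.
Proof.
rewrite /spread /=; case: eqP => [md|/eqP md].
  rewrite -place_single //; congr place; apply: gr_ext => n; rewrite /with_slots add1n eqSS.
  by case: eqP => // nm; rewrite single_neq // -md eq_sym; apply/eqP.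
rewrite (_ : with_slots _ _ = 0) ?linear0 //; apply: gr_ext => n.
by rewrite /with_slots add1n eqSS; case: eqP => // ->; rewrite single_neq // eq_sym.
Qed.

Lemma cmod_castE m n (e : m = n) (x : P m) : cmod_cast P e x = single x n.
Proof. by case: n / e => /=; rewrite singleE. Qed.

Lemma gb_single n (x : P n.+1) : gb (single x) = single (cyc_b x).
Proof.
apply: single_eqP => [|k nk]; first by rewrite /gb singleE.
by rewrite /gb single_neq ?linear0 // eqSS.
Qed.

Lemma gb_single0 (x : P 0) : gb (single x) = 0.
Proof. by apply: gr_ext => k; rewrite /gb single_neq ?linear0. Qed.

Lemma cyc_NE n (z : gr P) : gN z n = cyc_N (z n).
Proof. by apply: eq_bigr => i _; rewrite gtaunE. Qed.

Lemma gB_S n (z : gr P) : gB z n.+1 = cyc_B (z n).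
Proof.
by rewrite gBE gTE grBE gtauE !gRS cyc_NE.
Qed.

Lemma gB_0 (z : gr P) : gB z 0%N = 0.
Proof. by rewrite gBE gTE grBE gtauE /= linear0 scaler0 subr0. Qed.

Lemma gB_single n (x : P n) : gB (single x) = single (cyc_B x).
Proof.
apply: single_eqP => [|[|k] nk]; first by rewrite gB_S singleE.
  by rewrite gB_0.
by rewrite gB_S single_neq ?linear0.
Qed.

Lemma gsgn_single n (x : P n) : gsgn (single x) = (-1) ^+ n *: single x.
Proof.
apply: gr_ext => k; rewrite gsgnE grZE; case: (eqVneq n k) => [<-|nk] //.
by rewrite single_neq ?scaler0.
Qed.

End SingleDegree.

Lemma positions_flip a k m : positions a k (flip m) = positions (~~ a) k m.
Proof. by elim: m k => //= c m IH k; rewrite !IH; case: a IH; case: c. Qed.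

Section FrozenShuffle.
Variables P Q : cyclicModule.

(** The first slot is shared by a_0 and b_0, and the slot i.+1 belongs to x if i
    is one of the mu: then y has a unit there, which s_i inserts. *)
Lemma shuffle_pq_pure p q n (e : (p + q)%N = n) (x : P p) (y : Q q) :
  shuffle_pq e (pure x y) = gSH (single x) (single y) n :> cyc_prod P Q n.
Proof.
pose F u v : cyc_prod P Q n :=
  gpure (foldl (fun z i => gdegen i z) (single x) v)
     (foldl (fun z i => gdegen i z) (single y) u) n.
transitivity (\sum_(s : 'S_n | is_shuffle p s) (-1) ^+ s *:
    F (take p (perm_word s)) (drop p (perm_word s))).
  apply: eq_bigr => s _; congr (_ *: _); rewrite tensor_map_pure /= !cmod_castE.
  rewrite !single_degens /F /gpure.
  have sw := size_perm_word s.
  have sd : size (drop p (perm_word s)) = q by rewrite size_drop sw; lia.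
  have st : size (take p (perm_word s)) = p by rewrite size_takel // sw; lia.
  have nth_iota k (u : seq nat) : size u = k -> map (nth 0%N u) (iota 0 k) = u.
    by move=> <-; apply: mkseq_nth.
  by rewrite !nth_iota.
rewrite sum_shuffles; last by rewrite -e leq_addr.
rewrite /gSH /gsh gr_sumE big_mkcond; apply: eq_big_seq => m /size_masks sm.
rewrite /oword /word grZE /gpure /= !spread_single trues_flip.
case: eqP => [tm|_]; last by rewrite [pure _ _]linear0l scaler0.
have -> : falses m == q by apply/eqP; have := size_trues m; lia.
by rewrite positions_flip.
Qed.
End FrozenShuffle.

(** * Bilinear maps on the total complex *)

Section TotalSum.
Variables (X Y : nat -> lmodType rat) (W : lmodType rat).
Variable f : forall p q, tensor (X p) (Y q) -> W.

Definition total_sum n (z : tensor_total X Y n) : W :=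
  \sum_(p < n.+1) f (z p (n - p)%N (subnKC (leq_ord p))).

Lemma total_congr n (z : tensor_total X Y n) p q p' q'
    (e : (p + q)%N = n) (e' : (p' + q')%N = n) :
  p = p' -> q = q' -> f (z p q e) = f (z p' q' e').
Proof.
by move=> pp qq; case: p' / pp e'; case: q' / qq => e'; rewrite (eq_irrelevance e e').
Qed.

(** The components with p = 0 and those with q = 0 are separated since they
    receive nothing from the left and right parts of B, and contribute nothing
    to those of b. *)
Lemma total_sum_recl n (z : tensor_total X Y n.+1) :
  total_sum z = f (z 0%N n.+1 (add0n _)) +
    \sum_(p < n.+1) f (z p.+1 (n - p)%N (left_succ (subnKC (leq_ord p)))).
Proof.
rewrite /total_sum big_ord_recl; congr (_ + _).
  by apply: total_congr; rewrite ?subn0.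
by apply: eq_bigr => i _; apply: total_congr.
Qed.

Lemma total_sum_recr n (z : tensor_total X Y n.+1) :
  total_sum z =
    \sum_(p < n.+1) f (z p (n - p).+1 (right_succ (subnKC (leq_ord p)))) +
    f (z n.+1 0%N (addn0 _)).
Proof.
rewrite /total_sum big_ord_recr; congr (_ + _).
  by apply: eq_bigr => i _; apply: total_congr => //=; rewrite subSn ?leq_ord.
by apply: total_congr; rewrite ?subnn.
Qed.
End TotalSum.

Section Extension.
Variables P Q Y : cyclicModule.

Section Bilinear.
Variable F : {bilinear gr P -> gr Q -> gr Y}.

Definition on_singles p q (x : P p) (y : Q q) : gr Y := F (single x) (single y).

Fact on_singles_bilinear p q : bilinear_for *:%R *:%R (@on_singles p q).
Proof.
by split=> [y a x x'|x a y y'] /=; rewrite /on_singles linearP ?linearPl ?linearPr.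
Qed.
HB.instance Definition _ p q := bilinear_isBilinear.Build rat
  (P p) (Q q) (gr Y) *:%R *:%R (@on_singles p q) (@on_singles_bilinear p q).

Definition graded_lift p q (w : tensor (P p) (Q q)) : gr Y :=
  tensor_lift (@on_singles p q) w.
Fact graded_lift_linear p q : linear (@graded_lift p q).
Proof. exact: linearP. Qed.
HB.instance Definition _ p q := GRing.isLinear.Build rat
  (tensor (P p) (Q q)) (gr Y) _ (@graded_lift p q) (@graded_lift_linear p q).
Arguments graded_lift : simpl never.

Lemma graded_lift_pure p q (x : P p) (y : Q q) :
  graded_lift (pure x y) = F (single x) (single y).
Proof. exact: tensor_lift_pure. Qed.

(** The restriction of F to elements of one degree, summed over p + q = n.  Its
    values are whole families; the component that matters depends on the degree
    of F. *)
Definition total_lift n (z : tensor_total P Q n) : gr Y := total_sum (@graded_lift) z.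

Fact total_lift_linear n : linear (@total_lift n).
Proof.
move=> a z z'; rewrite /total_lift /total_sum scaler_sumr -big_split.
by apply: eq_bigr => p _; rewrite totalDE totalZE linearP.
Qed.
HB.instance Definition _ n := GRing.isLinear.Build rat
  (tensor_total P Q n) (gr Y) _ (@total_lift n) (@total_lift_linear n).
End Bilinear.

Arguments graded_lift : simpl never.
Lemma total_lift_eq0 (F : {bilinear gr P -> gr Q -> gr Y}) n (z : tensor_total P Q n) :
  (forall x y, F x y = 0) -> total_lift F z = 0.
Proof.
move=> F0; apply: big1 => p _; apply: (tensor_ext (g := \0)) => x y /=.
by rewrite graded_lift_pure.
Qed.

Lemma total_lift_eqN (F G : {bilinear gr P -> gr Q -> gr Y}) n (z : tensor_total P Q n) :
  (forall x y, F x y = - G x y) -> total_lift F z = - total_lift G z.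
Proof.
move=> FG; rewrite /total_lift /total_sum -sumrN; apply: eq_bigr => p _.
apply: (tensor_ext (f := @graded_lift F p _) (g := \- @graded_lift G p _)) => x y /=.
by rewrite !graded_lift_pure.
Qed.

Section Comm.
Variable F : {bilinear gr P -> gr Q -> gr Y}.
Notation commb := (comm_even (@gsgn P) (@gb P) (@gb Q) (@gb Y) F).
Notation commB := (comm_even (@gsgn P) (@gB P) (@gB Q) (@gB Y) F).

Definition left_b p q : {linear tensor (P p) (Q q) -> gr Y} :=
  match p return {linear tensor (P p) (Q q) -> gr Y} with
  | 0 => \0
  | p'.+1 => @graded_lift F p' q \o tensor_map (@cyc_b P p') idfun
  end.
Definition right_b p q : {linear tensor (P p) (Q q) -> gr Y} :=
  match q return {linear tensor (P p) (Q q) -> gr Y} with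
  | 0 => \0
  | q'.+1 => (-1) ^+ p \*: (@graded_lift F p q' \o tensor_map idfun (@cyc_b Q q'))
  end.

Lemma graded_lift_commb p q w : graded_lift commb w =
  gb (graded_lift F w) - left_b p q w - right_b p q w.
Proof.
apply: (tensor_ext (f := @graded_lift commb p q)
  (g := (@gb Y \o @graded_lift F p q) \- left_b p q \- right_b p q)) => x y /=.
rewrite !graded_lift_pure /= /comm_even /= gsgn_single linearZl_LR /=; congr (_ - _ - _).
  case: p x {w} => [|p] x /=; first by rewrite gb_single0 linear0l.
  by rewrite tensor_map_pure graded_lift_pure gb_single.
case: q y {w} => [|q] y /=; first by rewrite gb_single0 linear0r scaler0.
by rewrite tensor_map_pure graded_lift_pure gb_single.
Qed.

(** Commutators with total differentials are thus commutators of bilinear maps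
    on families, for which the identities are already known. *)
Lemma total_lift_commb n z : total_lift commb (n := n.+1) z =
  gb (total_lift F z) - total_lift F (@total_b (cyc_complex P) (cyc_complex Q) n z).
Proof.
rewrite /total_lift [total_sum _ z](eq_bigr _ (fun p _ => graded_lift_commb _)) !sumrB.
rewrite -addrA -opprD; congr (_ - _); first by rewrite linear_sum.
rewrite -[X in X + _]/(total_sum left_b z) -[X in _ + X]/(total_sum right_b z).
rewrite total_sum_recl total_sum_recr /= add0r addr0 -big_split.
by apply: eq_bigr => p _; rewrite /total_b linearD linearZ.
Qed.

Lemma total_lift_commb0 z : total_lift commb (n := 0) z = gb (total_lift F z).
Proof.
rewrite /total_lift /total_sum !big_ord1 graded_lift_commb /=.
by rewrite !subr0.
Qed.

Lemma graded_lift_commB p q w : graded_lift commB w = gB (graded_lift F w)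
  - graded_lift F (tensor_map (@cyc_B P p) idfun w)
  - (-1) ^+ p *: graded_lift F (tensor_map idfun (@cyc_B Q q) w).
Proof.
apply: (tensor_ext (f := @graded_lift commB p q)
  (g := (@gB Y \o @graded_lift F p q)
    \- (@graded_lift F p.+1 q \o tensor_map (@cyc_B P p) idfun)
    \- ((-1) ^+ p \*: (@graded_lift F p q.+1 \o tensor_map idfun (@cyc_B Q q))))) => x y /=.
rewrite !tensor_map_pure !graded_lift_pure /= /comm_even /= gsgn_single.
by rewrite linearZl_LR !gB_single.
Qed.

Lemma total_lift_commB n z : total_lift commB (n := n) z =
  gB (total_lift F z) - total_lift F (@total_B (cyc_complex P) (cyc_complex Q) n z).
Proof.
rewrite /total_lift [total_sum _ z](eq_bigr _ (fun p _ => graded_lift_commB _)) !sumrB.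
rewrite -addrA -opprD; congr (_ - _); first by rewrite linear_sum.
rewrite -[RHS]/(total_lift F (@total_Bl (cyc_complex P) (cyc_complex Q) n z +
  @total_Br (cyc_complex P) (cyc_complex Q) n z)) linearD /=; congr (_ + _).
  rewrite /total_lift total_sum_recl /= linear0 add0r; apply: eq_bigr => p _ /=.
  by congr (graded_lift F (tensor_map _ _ _)); congr (z _ _ _); apply: eq_irrelevance.
rewrite /total_lift total_sum_recr /= linear0 addr0; apply: eq_bigr => p _ /=.
rewrite [RHS]linearZ /=; congr (_ *: graded_lift F (tensor_map _ _ _)).
by congr (z _ _ _); apply: eq_irrelevance.
Qed.
End Comm.
End Extension.

Section Coextends.
Variables P Q : cyclicModule.
Local Notation Y := (cyc_prod P Q).

Definition component (M : nat -> lmodType rat) n (x : gr M) : M n := x n.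
Fact component_linear (M : nat -> lmodType rat) n : linear (@component M n).
Proof. by []. Qed.
HB.instance Definition _ (M : nat -> lmodType rat) n := GRing.isLinear.Build rat
  (gr M) (M n) _ (@component M n) (@component_linear M n).

Fact shuffle_pq_linear p q n (e : (p + q)%N = n) :
  linear (@shuffle_pq P Q p q n e).
Proof.
move=> a u v; rewrite /shuffle_pq scaler_sumr -big_split.
by apply: eq_bigr => s _; rewrite linearP scalerDr !scalerA mulrC.
Qed.
HB.instance Definition _ p q n (e : (p + q)%N = n) := GRing.isLinear.Build rat
  (tensor (P p) (Q q)) (Y n) _ (@shuffle_pq P Q p q n e) (shuffle_pq_linear e).

Lemma sh_total_lift n (z : tensor_total P Q n) : sh z = total_lift (@gSH P Q) z n.
Proof.
rewrite /sh /total_lift /total_sum gr_sumE; apply: eq_bigr => p _.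
apply: (tensor_ext (f := shuffle_pq (subnKC (leq_ord p)))
  (g := @component Y n \o @graded_lift P Q Y (@gSH P Q) p (n - p))) => x y /=.
by rewrite graded_lift_pure shuffle_pq_pure.
Qed.

Local Notation gSH' := (SHc (@gSH P Q) (@gSH2 P Q) (@gC P Q)).

Definition sh' n (z : tensor_complex (cyc_complex P) (cyc_complex Q) n) :
  cyc_complex Y n.+2 := total_lift gSH' z n.+2.

Fact sh'_linear n : linear (@sh' n).
Proof. by move=> a u v; rewrite /sh' linearP. Qed.
HB.instance Definition _ n := GRing.isLinear.Build rat
  (tensor_complex (cyc_complex P) (cyc_complex Q) n) (cyc_complex Y n.+2) _
  (@sh' n) (@sh'_linear n).

Lemma coextension2_sh' : coextension2 (@sh P Q) sh'.
Proof.
pose commb F := comm_even (@gsgn P) (@gb P) (@gb Q) (@gb Y) F.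
pose commB F := comm_even (@gsgn P) (@gB P) (@gB Q) (@gB Y) F.
have b_SH x y : commb (@gSH P Q) x y = 0.
  by rewrite /commb /comm_even gb_SH addrAC addrK subrr.
have b_SH' x y : commb gSH' x y = - commB (@gSH P Q) x y.
  apply: comm_even_b_SHc; [exact: gb_SH | exact: gb'_SH2 | exact: gT_C
    | exact: gb'_C | exact: gC_Tl | exact: gC_Tr | exact: gR_SH2].
have B_SH' x y : commB gSH' x y = 0 by apply: comm_even_B_SHc.
split=> n z.
- have := total_lift_commb (@gSH P Q) z; rewrite total_lift_eq0 // => /(congr1 (@^~ n)) e.
  by rewrite /commb0 !sh_total_lift; apply: esym e.
- have -> : commB0 (@sh P Q) z = total_lift (commB (@gSH P Q)) z n.+1.
    by rewrite /commB0 !sh_total_lift total_lift_commB grBE gB_S.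
  suff -> : commb2 sh' z = total_lift (commb gSH' : {bilinear _ -> _ -> _}) z n.+1.
    by rewrite (total_lift_eqN _ b_SH') grNE addNr.
  by case: n z => [|n] z; rewrite ?total_lift_commb ?total_lift_commb0.
have := total_lift_commB gSH' z; rewrite total_lift_eq0 // => /(congr1 (@^~ n.+3)).
by rewrite grBE gB_S => e; apply: esym e.
Qed.

End Coextends.

(** * Naturality *)

Section Map.
Variables (P P' : cyclicModule) (u : cyclicHom P P').
Implicit Types x : gr P.

Definition gmap x : gr P' := fun n => u n (x n).
Fact gmap_linear : linear gmap.
Proof. by move=> a x y; apply: gr_ext => n; rewrite !grE /gmap !grE linearP. Qed.
HB.instance Definition _ :=
  GRing.isLinear.Build rat (gr P) (gr P') _ gmap gmap_linear.

Lemma gmap_single n (x : P n) : gmap (single x) = single (u n x).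
Proof.
apply: single_eqP => [|k nk]; first by rewrite /gmap singleE.
by rewrite /gmap single_neq ?linear0.
Qed.

Lemma gmap_sgn x : gmap (gsgn x) = gsgn (gmap x).
Proof. by apply: gr_ext => n; rewrite /gmap /gsgn linearZ. Qed.
Lemma gmap_tau x : gmap (gtau x) = gtau (gmap x).
Proof. by apply: gr_ext => n; rewrite /gmap /gtau linearZ /= chom_cyc. Qed.
Lemma gmap_taun i x : gmap (gtaun i x) = gtaun i (gmap x).
Proof. by elim: i => //= i IH; rewrite !gtaunS gmap_tau IH. Qed.
Lemma gmap_T x : gmap (gT x) = gT (gmap x).
Proof. by rewrite !gTE linearB /= gmap_tau. Qed.
Lemma gmap_R x : gmap (gR x) = gR (gmap x).
Proof.
apply: gr_ext => -[|n]; rewrite /gmap /gR ?linear0 //.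
by rewrite chom_cyc chom_degen.
Qed.
Lemma gmap_d i x : gmap (gd i x) = gd i (gmap x).
Proof.
apply: gr_ext => n; rewrite /gmap /gd; case: ifP => i_n; last exact: linear0.
by rewrite chom_face // (leq_trans i_n).
Qed.
Lemma gmap_b x : gmap (gb x) = gb (gmap x).
Proof.
apply: gr_ext => n; rewrite /gmap /gb /cyc_b linear_sum; apply: eq_bigr => i _.
by rewrite linearZ /= chom_face // -ltnS.
Qed.
Lemma gmap_b' x : gmap (gb' x) = gb' (gmap x).
Proof.
apply: gr_ext => n; rewrite /gmap /gb' linear_sum; apply: eq_bigr => i _.
by rewrite linearZ /= chom_face // ltnW.
Qed.
Lemma gmap_N x : gmap (gN x) = gN (gmap x).
Proof.
apply: gr_ext => n; rewrite /gN -[LHS]/(u n _) linear_sum; apply: eq_bigr => i _.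
by rewrite -[LHS]/(gmap (gtaun i x) n) gmap_taun.
Qed.
Lemma gmap_B x : gmap (gB x) = gB (gmap x).
Proof. by rewrite !gBE gmap_T gmap_R gmap_N. Qed.

Lemma gmap_kappa x : gmap (gkappa x) = gkappa (gmap x).
Proof.
rewrite !gkappaE linearB /= gmap_b' /gomega !linearZ /= !gmap_R !gmap_d.
by rewrite gmap_b.
Qed.
Lemma gmap_pi x : gmap (gpi x) = gpi (gmap x).
Proof. by rewrite !gpiE linearB /= gmap_T gmap_R gmap_kappa. Qed.
Lemma gmap_rho x : gmap (grho x) = grho (gmap x).
Proof. by rewrite !grhoD linearD /= gmap_R gmap_pi gmap_kappa. Qed.
Lemma gmap_lambda x : gmap (glambda x) = glambda (gmap x).
Proof. by rewrite /glambda !gmap_R gmap_kappa. Qed.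

Lemma gmap_s i x : gmap (gs i x) = gs i (gmap x).
Proof.
apply: gr_ext => -[|n]; rewrite /gmap /gs ?linear0 //.
by case: ifP => i_n; rewrite ?linear0 ?chom_degen.
Qed.
Lemma gmap_place k m x : gmap (place k m x) = place k m (gmap x).
Proof.
elim: m k x => //= a m IH k x; rewrite IH; case: a => //.
by case: k => [|k]; rewrite /ins (gmap_R, gmap_s).
Qed.
Lemma gmap_spread m x : gmap (spread m x) = spread m (gmap x).
Proof.
rewrite /spread gmap_place; congr place; apply: gr_ext => n.
by rewrite /gmap /with_slots; case: ifP; rewrite ?linear0.
Qed.
End Map.

Section Product.
Variables (P P' Q Q' : cyclicModule) (u : cyclicHom P P') (v : cyclicHom Q Q').

Fact tensor_map_face n i : (i <= n.+1)%N -> forall x : cyc_prod P Q n.+1,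
  tensor_map (u n) (v n) (face (cyc_prod P Q) n i x) =
  face (cyc_prod P' Q') n i (tensor_map (u n.+1) (v n.+1) x).
Proof.
move=> i_n x; rewrite /= /prod_face !tensor_map_comp.
by apply: eq_tensor_map => y /=; rewrite chom_face.
Qed.

Fact tensor_map_degen n i : (i <= n)%N -> forall x : cyc_prod P Q n,
  tensor_map (u n.+1) (v n.+1) (degen (cyc_prod P Q) n i x) =
  degen (cyc_prod P' Q') n i (tensor_map (u n) (v n) x).
Proof.
move=> i_n x; rewrite /= /prod_degen !tensor_map_comp.
by apply: eq_tensor_map => y /=; rewrite chom_degen.
Qed.

Fact tensor_map_cyc n (x : cyc_prod P Q n) :
  tensor_map (u n) (v n) (cyc (cyc_prod P Q) n x) =
  cyc (cyc_prod P' Q') n (tensor_map (u n) (v n) x).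
Proof.
rewrite /= /prod_cyc !tensor_map_comp.
by apply: eq_tensor_map => y /=; rewrite chom_cyc.
Qed.

Definition prod_hom : cyclicHom (cyc_prod P Q) (cyc_prod P' Q') :=
  @CyclicHom (cyc_prod P Q) (cyc_prod P' Q') (fun n => tensor_map (u n) (v n))
    tensor_map_face tensor_map_degen tensor_map_cyc.

Local Notation U := (gmap u).
Local Notation V := (gmap v).
Local Notation UV := (gmap prod_hom).

Lemma gmap_word c m1 m2 x y : UV (word c m1 m2 x y) = word c m1 m2 (U x) (V y).
Proof.
rewrite /word linearZ /=; congr (_ *: _); apply: gr_ext => n.
by rewrite /gpure -!gmap_spread /gmap /= tensor_map_pure.
Qed.

Lemma gmap_SH x y : UV (gSH x y) = gSH (U x) (V y).
Proof.
apply: gr_ext => n; rewrite -[LHS]/(UV (gsh n x y) n) linear_sum /gSH.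
by congr (_ n); apply: eq_bigr => m _; apply: gmap_word.
Qed.

Lemma gmap_SH2 x y : UV (gSH2 x y) = gSH2 (U x) (V y).
Proof.
apply: gr_ext => n; rewrite -[LHS]/(UV (gsh2 n x y) n) linear_sum /gSH2.
by congr (_ n); apply: eq_bigr => m _; apply: gmap_word.
Qed.

Lemma gmap_C x y : UV (gC x y) = gC (U x) (V y).
Proof.
apply: gr_ext => n; rewrite -[LHS]/(UV (gcsh n (gsgn x) y) n) linear_sum /gC.
congr (_ n); apply: eq_bigr => m _ /=; rewrite linear_sum; apply: eq_bigr => i _ /=.
rewrite linear_sum; apply: eq_bigr => j _ /=.
by rewrite [LHS]gmap_word !gmap_taun gmap_sgn.
Qed.

Local Notation K P Q := (gK (@gSH P Q) (@gSH2 P Q)).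
Local Notation M P Q := (gM (@gC P Q)).
Local Notation gSH' P Q := (SHc (@gSH P Q) (@gSH2 P Q) (@gC P Q)).

Lemma gmap_K x y : UV (K P Q x y) = K P' Q' (U x) (V y).
Proof.
rewrite /gK linearB linearD /= !gmap_R !gmap_SH gmap_SH2.
by rewrite !gmap_lambda gmap_rho gmap_sgn !gmap_kappa.
Qed.

Lemma gmap_M x y : UV (M P Q x y) = M P' Q' (U x) (V y).
Proof. by rewrite /gM gmap_T gmap_R gmap_C !gmap_pi. Qed.

Lemma gmap_SHc x y : UV (gSH' P Q x y) = gSH' P' Q' (U x) (V y).
Proof.
have UVD a b : UV (a + b) = UV a + UV b by exact: linearD.
rewrite /SHc /comm_odd 3!UVD gmap_M gmap_B !gmap_K.
by rewrite !gmap_B gmap_sgn.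
Qed.

Lemma sh'_natural n (z : tensor_complex (cyc_complex P) (cyc_complex Q) n) :
  tensor_map (u n.+2) (v n.+2) (sh' z) = sh' (total_map u v z).
Proof.
rewrite -[LHS]/(UV (total_lift (gSH' P Q) z) n.+2) linear_sum /sh'; congr (_ n.+2).
apply: eq_bigr => p _; rewrite /total_map.
apply: (tensor_ext (f := UV \o @graded_lift P Q _ (gSH' P Q) p (n - p)%N) (g :=
  @graded_lift P' Q' _ (gSH' P' Q') p (n - p)%N \o
    tensor_map (u p) (v (n - p)%N))) => x y.
by rewrite /= tensor_map_pure !graded_lift_pure /= gmap_SHc !gmap_single.
Qed.
End Product.

Theorem proposition2p1 :
  exists sh' : forall (P Q : cyclicModule) (n : nat),
      {linear tensor_complex (cyc_complex P) (cyc_complex Q) n ->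
              cyc_complex (cyc_prod P Q) n.+2},
    (forall (P P' Q Q' : cyclicModule) (u : cyclicHom P P')
        (v : cyclicHom Q Q') (n : nat)
        (z : tensor_complex (cyc_complex P) (cyc_complex Q) n),
      tensor_map (u n.+2) (v n.+2) (sh' P Q n z) =
      sh' P' Q' n (total_map u v z)) /\
    (forall P Q : cyclicModule, coextension2 (@sh P Q) (sh' P Q)).
Proof.
exists (fun P Q n => @sh' P Q n); split => [P P' Q Q' u v n z|P Q].
  exact: sh'_natural.
exact: coextension2_sh'.
Qed.
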